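(* For all integers $h\ge 1$ and $\ell\ge 1$ there exists a $\mathrm{GDD}(4,5,\,5\cdot 2^\ell\cdot 9h+(5\cdot 2^\ell-3)\cdot 9h)$ of type $(9h)^{5\cdot 2^\ell}\,((5\cdot 2^\ell-3)\cdot 9h)^1$.
   Context: A group divisible design $\mathrm{GDD}(t,k,m)$ of type $g_1^{n_1} g_2^{n_2}\cdots g_r^{n_r}$, where $t \ge 2$ and $m=\sum_{i=1}^r n_i g_i$, is a triple $(X,G,B)$ such that $X$ is a set of $m$ points; $G$ is a partition of $X$ into $n=\sum_{i=1}^r n_i$ groups, of which $n_i$ have exactly $g_i$ points, $1\le i\le r$; $B$ is a set of $k$-subsets of $X$ (blocks); each block contains at most one point from each group; and each $t$-subset of $X$ which contains at most one point from each group is contained in exactly one block of $B$. *)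

(* Defs.v *)
From mathcomp Require Import all_boot.

Set Implicit Arguments.
Unset Strict Implicit.
Unset Printing Implicit Defensive.

Definition transverse (X : finType) (G : {set {set X}}) (A : {set X}) : Prop :=
  forall g : {set X}, g \in G -> #|A :&: g| <= 1.

(* The point set is the whole finite type X. The type
   g_1^{n_1} ... g_r^{n_r} is the list ty = [:: (g_1, n_1); ...; (g_r, n_r)];
   tally_seq ty lists each g_i repeated n_i times. *)
Record is_GDD (t k m : nat) (ty : seq (nat * nat))
    (X : finType) (G B : {set {set X}}) : Prop := IsGDD {
  GDD_strength : 2 <= t;
  GDD_order : m = \sum_(gn <- ty) gn.2 * gn.1;
  GDD_points : #|X| = m;
  GDD_groups : partition G [set: X];
  GDD_type : perm_eq [seq #|g| | g : {set X} in G] (tally_seq ty);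
  GDD_block_size : forall b : {set X}, b \in B -> #|b| = k;
  GDD_block_transverse : forall b : {set X}, b \in B -> transverse G b;
  GDD_cover : forall T : {set X}, #|T| = t -> transverse G T ->
    exists! b : {set X}, b \in B /\ T \subset b
}.

Definition GDD_exists (t k m : nat) (ty : seq (nat * nat)) : Prop :=
  exists (X : finType) (G B : {set {set X}}), is_GDD t k m ty G B.

(* Main.v *)
Require Import Defs.
From mathcomp Require Import all_boot.
From mathcomp Require Import all_algebra.
From mathcomp Require Import ring zify.

Set Implicit Arguments.
Unset Strict Implicit.
Unset Printing Implicit Defensive.

Import GRing.Theory.

(** Let n = 5 * 2 ^ l and g = 9 * h.  A triple of points in distinct small groups has (n - 3) * g
    candidates for a fourth point in a further small group, and the large group has exactly
    (n - 3) * g points.  So it suffices to colour the transverse quadruples of small-group points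
    by the points of the large group in such a way that two quadruples sharing three points get
    different colours: by counting, each colour then occurs exactly once among the quadruples
    through a given triple, and the blocks are the quadruples completed by their colours
    ([GDD_of_colouring]).

    Such a colouring follows from 9 * (n - 3) systems of quadruples on an n-set such that two
    quadruples of one system share at most two points, while every quadruple belongs to at least
    9 systems ([GDD_of_systems]): a large set of Steiner quadruple systems with multiplicity 9.
    A transverse quadruple gets the system whose rank among those containing its projection is the
    sum of the four Z_9-levels; cancelling this sum gives properness, and the factor h is carried
    by a further sum of levels.

    The n-set is Y x V with Y of size 10 and V an elementary abelian 2-group.  For each non-zero s
    in V there are 90 systems, and 63 more systems belong to s = 0.  For a quadruple, let the
    elements of V that it uses be its levels.

    - Quadruples on one or two levels are handled by explicit designs on 10 points.  The 63 images
      of a Steiner quadruple system under a group of order 63 contain every quadruple of Y exactly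
      9 times.  Across levels u and u + s, a bijection of Y transports one level to the other:
      three points on one level and one on the other form a block when transport yields a Steiner
      block, and two pairs form a block when they correspond.  The 90 bijections used send each
      point to each point 9 times and each pair to each pair exactly twice; the other 7 systems
      containing two given pairs are among the 63, by a one-factorisation of the complete graph
      on Y.

    - Quadruples on at least three levels are coloured by algebra, with Y = Z_10 = Z_5 x Z_2, each
      coarse colour standing for 9 systems ([coarse]).  If the levels are distinct with sum s <> 0,
      the colour is s with the sum of the Y-coordinates.  If the levels are distinct with sum 0,
      they form an affine plane of V, and the sum of the Y-coordinates sorts the quadruples into
      ten codes: three of them are attached to the three directions s of the plane and coloured
      with s by a linear form, and the other seven serve s = 0.  If the levels are u, u, v, w,
      then s = v + w, and with the fourth corner u + v + w of the plane the quadruple is coloured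
      like the codeword through the midpoint of its two points on level u.  If such a quadruple
      and a codeword had three common points and the same colour, the labels modulo 5 would make
      that midpoint an endpoint, so the two points would agree modulo 5, and the labels modulo 2
      would identify them ([coarse_mixed]). *)

(** * Group divisible designs from proper colourings *)
Section GroupsOfFibres.

Variables (P I : finType) (f : P -> I).

Definition fibre (i : I) : {set P} := f @^-1: [set i].

Lemma in_fibre i x : (x \in fibre i) = (f x == i).
Proof. by rewrite !inE. Qed.

Definition fibres : {set {set P}} := [set fibre i | i : I].

Hypothesis f_surj : forall i, exists x, f x = i.

Lemma fibre_inj : injective fibre.
Proof.
move=> i j eq_ij; have [x fx] := f_surj i.
by apply/eqP; rewrite -fx -in_fibre -eq_ij in_fibre fx.
Qed.

Lemma fibres_partition : partition fibres [set: P].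
Proof.
apply/and3P; split.
- apply/eqP/setP=> x; rewrite inE; apply/bigcupP; exists (fibre (f x)).
    exact: imset_f.
  by rewrite in_fibre.
- apply/trivIsetP=> _ _ /imsetP[i _ ->] /imsetP[j _ ->] neq_ij.
  rewrite -setI_eq0; apply/eqP/setP=> x; rewrite !inE.
  by apply/negP=> /andP[/eqP fi /eqP fj]; case/eqP: neq_ij; rewrite -fi -fj.
- apply/negP=> /imsetP[i _ /setP h0]; have [x fx] := f_surj i.
  by have := h0 x; rewrite in_fibre fx eqxx inE.
Qed.

Lemma fibres_card : perm_eq [seq #|g| | g : {set P} in fibres] [seq #|fibre i| | i : I].
Proof.
have -> : [seq #|fibre i| | i : I] = [seq #|g : {set P}| | g <- [seq fibre i | i : I]].
  by rewrite -map_comp.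
apply/perm_map/uniq_perm; rewrite ?enum_uniq //.
  by rewrite map_inj_uniq ?enum_uniq //; exact: fibre_inj.
move=> g; rewrite mem_enum; apply/imsetP/mapP => -[i _ ->]; exists i => //.
by rewrite mem_enum.
Qed.

Lemma transverse_fibres (A : {set P}) : transverse fibres A <-> {in A &, injective f}.
Proof.
split=> [trA x y Ax Ay fxy | injA _ /imsetP[i _ ->]].
  have /card_le1_eqP := trA (fibre (f x)) (imset_f _ isT).
  by apply; rewrite inE ?Ax ?Ay /= in_fibre ?fxy.
apply/card_le1_eqP=> x y; rewrite !inE => /andP[Ax /eqP fx] /andP[Ay /eqP fy].
by apply: injA; rewrite ?fx.
Qed.

End GroupsOfFibres.

Section GDDOfColouring.

Variables (X L K : finType) (col : {set X * L} -> K).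

Implicit Types (Q T : {set X * L}) (k : K).

Definition partial (Q : {set X * L}) := #|[set x.1 | x in Q]| == #|Q|.

Lemma partialP Q : reflect {in Q &, injective fst} (partial Q).
Proof. exact: imset_injP. Qed.

Hypotheses (X_gt3 : 3 < #|X|) (L_gt0 : 0 < #|L|).
Hypothesis card_K : #|K| = (#|X| - 3) * #|L|.
Hypothesis col_proper : forall (T : {set X * L}) x y, #|T| = 3 ->
  x \notin T -> y \notin T -> partial (x |: T) -> partial (y |: T) ->
  col (x |: T) = col (y |: T) -> x = y.

(** As many colours as candidates for the fourth point: properness makes the colour an injective
    function of that point, hence a surjective one. *)
Lemma col_surj (T : {set X * L}) k : #|T| = 3 -> partial T ->
  exists x, [/\ x \notin T, partial (x |: T) & col (x |: T) = k].
Proof.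
move=> T3 pT; pose D := setX (~: [set x.1 | x in T]) [set: L].
have DP x : x \in D -> x \notin T /\ partial (x |: T).
  rewrite !inE andbT => xT; have xT' : x \notin T.
    by apply: contraNN xT => xT; apply: imset_f.
  split=> //; rewrite /partial imsetU1 !cardsU1 xT xT'.
  by rewrite (eqP pT).
have injD : {in D &, injective (fun x => col (x |: T))}.
  by move=> x y /DP[xT px] /DP[yT py]; apply: col_proper.
(* D has (n - 3) * #|L| elements, as many as there are colours. *)
have: [set col (x |: T) | x in D] == [set: K].
  rewrite eqEcard subsetT /= cardsT card_in_imset // cardsX cardsT card_K.
  by rewrite cardsCs setCK (eqP pT) T3.
move/eqP/setP/(_ k); rewrite inE => /imsetP[x xD ->]; exists x.
by have [] := DP x xD.
Qed.

Local Notation P := ((X * L) + K)%type.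

Definition group_of (p : P) : option X := if p is inl x then Some x.1 else None.

Definition block (Q : {set X * L}) : {set P} := inr (col Q) |: (inl @: Q).

Lemma inl_block Q x : (inl x \in block Q) = (x \in Q).
Proof. by rewrite !inE /= mem_imset //; exact: inl_inj. Qed.

Lemma inr_block Q k : (inr k \in block Q) = (k == col Q).
Proof.
rewrite !inE; case: eqP => [[->]|neq] /=; first by rewrite eqxx.
have -> : (inr k \in inl @: Q) = false by apply/imsetP=> -[].
by apply/esym/eqP=> k_col; case: neq; rewrite k_col.
Qed.

Lemma card_block Q : #|block Q| = #|Q|.+1.
Proof.
rewrite cardsU1 card_imset; last exact: inl_inj.
by have -> : inr (col Q) \notin inl @: Q by apply/imsetP=> -[].
Qed.

Lemma block_transversal Q : partial Q -> {in block Q &, injective group_of}.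
Proof.
move=> /partialP injQ [x|k] [y|k'] //=; rewrite ?inl_block ?inr_block.
  by move=> Qx Qy [xy]; rewrite (injQ x y).
by move=> /eqP-> /eqP->.
Qed.

(** A transverse 4-set either avoids the last group, and then its colour completes it to a block,
    or consists of a colour and a triple, completed by [col_surj]. *)
Lemma GDD_of_colouring :
  GDD_exists 4 5 (#|X| * #|L| + #|K|) [:: (#|L|, #|X|); (#|K|, 1)].
Proof.
have K_gt0 : 0 < #|K| by rewrite card_K muln_gt0 subn_gt0 X_gt3.
have surj : forall i, exists p, group_of p = i.
  case=> [x|].
    by case/card_gt0P: L_gt0 => l _; exists (inl (x, l)).
  by case/card_gt0P: K_gt0 => k _; exists (inr k).
exists P, (fibres group_of), (block @: [set Q : {set X * L} | (#|Q| == 4) && partial Q]).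
split=> //.
- by rewrite !big_cons big_nil /= addn0 mul1n.
- by rewrite card_sum card_prod.
- exact: fibres_partition.
- apply: perm_trans (fibres_card surj) _.
  have cS x : #|fibre group_of (Some x)| = #|L|.
    have -> : fibre group_of (Some x) = [set inl (x, l) | l : L].
      apply/setP=> -[[x' l]|k]; rewrite in_fibre /=; apply/eqP/imsetP => //.
      - by case=> ->; exists l.
      - by case=> l' _ [-> _].
      - by case.
    by rewrite card_imset // => l l' [].
  have cN : #|fibre group_of None| = #|K|.
    have -> : fibre group_of None = [set inr k | k : K].
      apply/setP=> -[x|k]; rewrite in_fibre /=; apply/eqP/imsetP => //.
      - by case.
      - by exists k.
    by rewrite card_imset // => k k' [].
  have -> : tally_seq [:: (#|L|, #|X|); (#|K|, 1)] =
      rcons [seq #|L| | x : X] #|K|.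
    rewrite /tally_seq /= cats1; congr rcons.
    have : all (pred1 #|L|) [seq #|L| | x : X] by apply/allP=> _ /mapP[x _ ->] /=.
    by move/all_pred1P; rewrite size_map -cardE => ->.
  have enumO : perm_eq [seq #|fibre group_of o| | o : option X]
     [seq #|fibre group_of o| | o <- None :: [seq Some x | x : X]].
    apply/perm_map/uniq_perm; rewrite ?enum_uniq //=.
      rewrite map_inj_uniq ?enum_uniq ?andbT; last by move=> x y [].
      by apply/mapP=> -[].
    case=> [x|]; rewrite mem_enum inE //=.
    by apply/esym/mapP; exists x; rewrite ?mem_enum.
  apply: perm_trans enumO _.
  rewrite /= cN -map_comp (eq_map (_ : _ =1 (fun=> #|L|))) => [|x /=]; last exact: cS.
  by rewrite perm_sym perm_rcons.
- move=> b /imsetP[Q]; rewrite inE => /andP[/eqP Q4 _] ->.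
  by rewrite card_block Q4.
- move=> b /imsetP[Q]; rewrite inE => /andP[_ pQ] ->.
  by apply/transverse_fibres; exact: block_transversal.
move=> T T4 /transverse_fibres injT.
pose TL := [set x | inl x \in T].
have inTL x : (x \in TL) = (inl x \in T) by rewrite inE.
have pTL : partial TL.
  apply/partialP=> x y; rewrite !inTL => Tx Ty xy.
  by have [] := injT _ _ Tx Ty (congr1 Some xy).
have [/existsP[k Tk]|noK] := boolP [exists k, inr k \in T]; last first.
  have TE : T = inl @: TL.
    apply/setP=> -[x|k]; first by rewrite mem_imset ?inTL //; exact: inl_inj.
    have -> : (inr k \in inl @: TL) = false by apply/imsetP=> -[].
    by apply: contraNF noK => Tk; apply/existsP; exists k.
  have TL4 : #|TL| = 4 by rewrite -T4 TE card_imset //; exact: inl_inj.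
  exists (block TL); split.
    split; first by apply: imset_f; rewrite inE TL4 eqxx.
    by rewrite TE subsetUr.
  move=> b [/imsetP[Q]]; rewrite inE => /andP[/eqP Q4 pQ] -> /subsetP sTQ.
  congr block; apply/eqP; rewrite eqEcard TL4 Q4 andbT.
  by apply/subsetP=> x; rewrite inTL => /sTQ; rewrite inl_block.
have TE : T = inr k |: inl @: TL.
  apply/setP=> -[x|k']; rewrite !inE.
    by rewrite mem_imset ?inTL //; exact: inl_inj.
  have -> : (inr k' \in inl @: TL) = false by apply/imsetP=> -[].
  rewrite orbF; apply/idP/eqP=> [Tk'|->//].
  exact: (injT _ _ Tk' Tk).
have TL3 : #|TL| = 3.
  have := T4; rewrite TE cardsU1 card_imset; last exact: inl_inj.
  have -> : inr k \notin inl @: TL by apply/imsetP=> -[].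
  by case.
have [x [xT px colx]] := col_surj k TL3 pTL.
have x4 : #|x |: TL| = 4 by rewrite cardsU1 xT TL3.
exists (block (x |: TL)); split.
  split; first by apply: imset_f; rewrite inE x4 eqxx.
  by rewrite TE /block colx setUS // imsetS // subsetUr.
move=> b [/imsetP[Q]]; rewrite inE => /andP[/eqP Q4 pQ] -> /subsetP sTQ.
have sTLQ : TL \subset Q by apply/subsetP=> y; rewrite inTL => /sTQ; rewrite inl_block.
have kQ : k = col Q by apply/eqP; rewrite -inr_block sTQ.
have /card_gt0P[y] : 0 < #|Q :\: TL| by rewrite cardsDS // Q4 TL3.
rewrite inE => /andP[yT yQ].
have QE : Q = y |: TL.
  apply/esym/eqP; rewrite eqEcard cardsU1 yT TL3 Q4 andbT.
  by rewrite subUset sub1set yQ.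
rewrite QE; congr (block (_ |: _)).
by apply: (col_proper TL3) => //; rewrite -?QE // colx kQ.
Qed.

End GDDOfColouring.

(** * Proper colourings from packings with multiplicity *)
Section Lifting.

Variables (X C : finType) (mu h : nat) (sys : C -> {set X} -> bool).

Hypotheses (X_gt3 : 3 < #|X|) (mu_gt0 : 0 < mu) (h_gt0 : 0 < h).
Hypothesis card_C : #|C| = (#|X| - 3) * mu.
Hypothesis sys_packing : forall c (T : {set X}) x y, #|T| = 3 ->
  x \notin T -> y \notin T -> sys c (x |: T) -> sys c (y |: T) -> x = y.
Hypothesis sys_cover : forall Q : {set X}, #|Q| = 4 -> mu <= #|[set c | sys c Q]|.

(** Projecting a properly coloured pair of lifted quadruples to X gives two quadruples of the same
    system, so they have the same projection by [sys_packing]; then their ranks in the same list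
    of systems agree, which determines the last level. *)
Lemma GDD_of_systems :
  GDD_exists 4 5 (#|X| * (mu * h) + (#|X| - 3) * (mu * h))
    [:: (mu * h, #|X|); ((#|X| - 3) * (mu * h), 1)].
Proof.
case: mu mu_gt0 card_C sys_cover => // mu' _ card_C' sys_cover'.
case: h h_gt0 => // h' _.
pose L := ('I_mu'.+1 * 'I_h'.+1)%type; pose K := (C * 'I_h'.+1)%type.
have cardL : #|{: L}| = mu'.+1 * h'.+1 by rewrite card_prod !card_ord.
have cardK : #|{: K}| = (#|X| - 3) * (mu'.+1 * h'.+1).
  by rewrite card_prod card_C' card_ord mulnA.
have [c0 _] : exists c : C, c \in C.
  by apply/card_gt0P; rewrite card_C' muln_gt0 subn_gt0 X_gt3.
(* The first summand of L ranks systems, the second one is the surplus factor h. *)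
pose proj (Q : {set X * L}) := [set x.1 | x in Q].
pose rank (Q : {set X * L}) := (\sum_(x in Q) x.2.1)%R.
pose col (Q : {set X * L}) : K :=
  (nth c0 (enum [set c | sys c (proj Q)]) (rank Q), (\sum_(x in Q) x.2.2)%R).
rewrite -cardK -cardL; apply: (@GDD_of_colouring _ _ _ col) => //.
- by rewrite cardL.
- by rewrite cardK cardL.
move=> T x y T3 xT yT px py [eq_c eq_h].
have rank_lt z : z \notin T -> partial (z |: T) ->
    rank (z |: T) < #|[set c | sys c (proj (z |: T))]|.
  move=> zT /eqP pz; apply: leq_trans (ltn_ord _) (sys_cover' _ _).
  by rewrite [LHS]pz cardsU1 zT T3.
have mem_c z : z \notin T -> partial (z |: T) ->
    sys (nth c0 (enum [set c | sys c (proj (z |: T))]) (rank (z |: T))) (proj (z |: T)).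
  move=> zT pz; set c := nth _ _ _; suff: c \in [set c | sys c (proj (z |: T))] by rewrite inE.
  by rewrite -mem_enum mem_nth // -cardE rank_lt.
have projU z : proj (z |: T) = z.1 |: proj T by rewrite /proj imsetU1.
have pT : #|proj T| = 3.
  rewrite card_in_imset // => u v uT vT.
  by move/partialP: px; apply; rewrite inE ?uT ?vT orbT.
have new z : z \notin T -> partial (z |: T) -> z.1 \notin proj T.
  move=> zT /partialP pz; apply/imsetP=> -[u uT zu].
  by case/negP: zT; rewrite (pz z u) // !inE ?eqxx ?uT ?orbT.
have xy1 : x.1 = y.1.
  apply: (sys_packing pT (new x xT px) (new y yT py) (c := (col (x |: T)).1)).
    by rewrite -projU mem_c.
  by rewrite /= eq_c -projU mem_c.
have eq_rank : rank (x |: T) = rank (y |: T).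
  apply/val_inj/eqP; move/eqP: eq_c; rewrite !projU xy1 -projU nth_uniq ?enum_uniq //.
    by rewrite -cardE projU -xy1 -projU rank_lt.
  by rewrite -cardE rank_lt.
have xy2 : x.2.1 = y.2.1.
  by move: eq_rank; rewrite /rank !big_setU1 //= => /GRing.addIr.
have xy3 : x.2.2 = y.2.2.
  by move: eq_h; rewrite !big_setU1 //= => /GRing.addIr.
by case: x y xy1 xy2 xy3 {xT yT px py eq_c eq_h eq_rank} => [? [? ?]] [? [? ?]] /= -> -> ->.
Qed.

End Lifting.

(** * Designs on ten points *)

(** Developed modulo 10, they give the cyclic Steiner quadruple system of order 10. *)
Definition base_blocks := [:: [:: 0; 1; 3; 4]; [:: 0; 1; 2; 6]; [:: 0; 2; 4; 7]].

Definition blocks : seq (seq nat) :=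
  [seq [seq (x + i) %% 10 | x <- b] | b <- base_blocks, i <- iota 0 10].

(** Blocks are tested against a membership predicate rather than a list, so that the same test
    applies to finite sets and, in the computations, to short lists of numbers. *)
Definition has_block (p : nat -> bool) := has (all p) blocks.

(** Brings the cyclic system into a position where its orbit under the group of order 63 below
    covers all quadruples evenly. *)
Definition twist (x : nat) := nth 0 [:: 0; 1; 2; 3; 4; 7; 5; 6; 8; 9] x.

(** With the ten points read as Z_7 followed by Z_3, the index i < 63 runs through the group of
    the maps (x -> m * x + t, y -> y + c) with m in {1, 2, 4}; since 2 = - 7 modulo 3, the offset 2
    undoes the shift by 7 of the points of Z_3. *)
Definition relabelling_nat (i x : nat) :=
  twist (if x < 7 then (2 ^ (i %/ 21) * x + i) %% 7 else 7 + (x + i %/ 7 + 2) %% 3).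

(** An isomorphism from the affine plane Z_3 x Z_3 (v = 3 * a + b) to the plane whose points are
    1, ..., 9 and whose lines are the blocks through 0, with 0 removed. *)
Definition chart (v : nat) := nth 0 [:: 1; 2; 6; 3; 5; 7; 4; 8; 9] v.

(** The ten points are also the affine plane over Z_3 with 9 as a point at infinity.  The index
    g = 9 * p + h selects the bijection sending infinity to p and the plane, translated by h, to
    the plane of the blocks through p.  The nine translations make any pair of points on a line
    of direction d go to all the pairs on lines of the corresponding direction at p.  With a
    quarter turn of the source for odd p, the directions at the ten points are matched such that
    each pair of points lies on a line of each given direction at two points p. *)
Definition bridge_nat (g y : nat) :=
  let p := g %/ 9 in let h := g %% 9 in
  if y == 9 then p else
  let: (a, b) := if odd p then (3 - y %% 3, y %/ 3) else (y %/ 3, y %% 3) in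
  (p + chart (3 * ((a + h %/ 3) %% 3) + (b + h) %% 3)) %% 10.

Definition row (f : nat -> nat -> nat) i := [seq f i x | x <- iota 0 10].

Definition table f n := [seq row f i | i <- iota 0 n].

Lemma nth_row f i x : x < 10 -> nth 0 (row f i) x = f i x.
Proof. by move=> x_10; rewrite (nth_map 0) ?size_iota // nth_iota. Qed.

Lemma card_ord_count n (P : pred nat) : #|[set i : 'I_n | P i]| = count P (iota 0 n).
Proof.
by rewrite cardsE cardE -val_enum_ord count_map -size_filter enumT.
Qed.

Lemma card_table f n (P : pred (seq nat)) :
  #|[set i : 'I_n | P (row f i)]| = count P (table f n).
Proof. by rewrite (card_ord_count _ (fun i => P (row f i))) count_map. Qed.

Definition all_from (m : nat) (P : nat -> bool) := all P (iota m (10 - m)).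

Lemma all_fromP m P : all_from m P -> forall x : 'I_10, m <= x -> P x.
Proof.
move=> /allP allP x mx; apply: allP; rewrite mem_iota mx /=.
by rewrite subnKC ?ltn_ord // (leq_trans mx) // ltnW.
Qed.

Lemma relabelling_nat_ok :
  all (fun r => uniq r && all (gtn 10) r) (table relabelling_nat 63).
Proof. by vm_compute. Qed.

Lemma bridge_nat_ok :
  all (fun r => uniq r && all (gtn 10) r) (table bridge_nat 90).
Proof. by vm_compute. Qed.

Lemma blocks_lt10 : all (all (gtn 10)) blocks.
Proof. by vm_compute. Qed.

Lemma blocks_steiner : all_from 0 (fun a => all_from a.+1 (fun b => all_from b.+1 (fun c =>
  count (fun d => (d \notin [:: a; b; c]) && has_block [in [:: d; a; b; c]]) (iota 0 10) == 1))).
Proof. by vm_compute. Qed.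

(** Binding the table to R shares its evaluation between all the checks. *)
Lemma blocks_large_set : (fun R =>
  all_from 0 (fun a => all_from a.+1 (fun b => all_from b.+1 (fun c => all_from c.+1 (fun d =>
    9 <= count (fun r => let l := [:: nth 0 r a; nth 0 r b; nth 0 r c; nth 0 r d] in
      has_block (fun x => has (eqn x) l)) R))))) (table relabelling_nat 63).
Proof. by vm_compute. Qed.

Lemma bridge_nat_point : (fun R => all_from 0 (fun a => all_from 0 (fun b =>
  9 <= count (fun r => eqn (nth 0 r a) b) R))) (table bridge_nat 90).
Proof. by vm_compute. Qed.

(** This is the reason for the choice of the 90 bijections: pairs go to pairs uniformly. *)
Lemma bridge_nat_pair : (fun R => all_from 0 (fun a => all_from a.+1 (fun b =>
  all_from 0 (fun c => all_from c.+1 (fun d =>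
    2 <= count (fun r => let x := nth 0 r a in let y := nth 0 r b in
      if eqn x c then eqn y d else if eqn x d then eqn y c else false) R)))))
  (table bridge_nat 90).
Proof. by vm_compute. Qed.

Definition ord_map (f : nat -> nat -> nat) n (i : 'I_n) (x : 'I_10) : 'I_10 := inord (f i x).

Lemma ord_map_ok f n (i : 'I_n) : all (fun r => uniq r && all (gtn 10) r) (table f n) ->
  (forall x, val (ord_map f i x) = f i x) /\ injective (ord_map f i).
Proof.
move=> /allP/(_ (row f i)); rewrite map_f ?mem_iota ?add0n ?ltn_ord //.
move=> /(_ isT)/andP[uniq_r /allP lt_r].
have valE x : val (ord_map f i x) = f i x.
  by rewrite /= inordK //; apply: lt_r; rewrite map_f // mem_iota /= ltn_ord.
split=> // x y eq_xy; apply/val_inj/eqP.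
rewrite -(nth_uniq 0 _ _ uniq_r) ?size_map ?size_iota ?ltn_ord //.
by rewrite !nth_row ?ltn_ord // -!valE eq_xy.
Qed.

Definition relabelling := @ord_map relabelling_nat 63.
Definition bridge := @ord_map bridge_nat 90.

Lemma relabellingE i x : val (relabelling i x) = relabelling_nat i x.
Proof. by case: (ord_map_ok i relabelling_nat_ok). Qed.
Lemma relabelling_inj i : injective (relabelling i).
Proof. by case: (ord_map_ok i relabelling_nat_ok). Qed.
Lemma bridgeE g x : val (bridge g x) = bridge_nat g x.
Proof. by case: (ord_map_ok g bridge_nat_ok). Qed.
Lemma bridge_inj g : injective (bridge g).
Proof. by case: (ord_map_ok g bridge_nat_ok). Qed.

Definition steiner (A : {set 'I_10}) := (#|A| == 4) && has_block (fun x => inord x \in A).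

Lemma eq_has_block (p q : nat -> bool) : (forall x : 'I_10, p x = q x) -> has_block p = has_block q.
Proof.
move=> pq; apply: eq_in_has => b b_blocks; apply: eq_in_all => x xb.
have x_10 : x < 10 by apply: (allP (allP blocks_lt10 _ b_blocks)).
by rewrite -[x]/(val (Ordinal x_10)) pq.
Qed.

Lemma enum_ord_sorted n (A : {set 'I_n}) : sorted ltn (map val (enum A)).
Proof.
have -> : enum A = [seq x <- enum 'I_n | x \in A] by rewrite enumT.
have /subseq_sorted : subseq (map val [seq x <- enum 'I_n | x \in A]) (iota 0 n).
  by rewrite -val_enum_ord map_subseq // filter_subseq.
by apply; [exact: ltn_trans | exact: iota_ltn_sorted].
Qed.

Lemma cards2_sorted n (A : {set 'I_n}) : #|A| = 2 -> exists a b : 'I_n, a < b /\ A = [set a; b].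
Proof.
rewrite cardE; move: (enum_ord_sorted A) (set_enum A).
case: (enum A) => [|a [|b []]] //= /andP[ab _] <- _; exists a, b; split=> //.
by apply/setP=> x; rewrite !inE.
Qed.

Lemma cards3_sorted n (A : {set 'I_n}) : #|A| = 3 ->
  exists a b c : 'I_n, [/\ a < b, b < c & A = [set a; b; c]].
Proof.
rewrite cardE; move: (enum_ord_sorted A) (set_enum A).
case: (enum A) => [|a [|b [|c []]]] //= /and3P[ab bc _] <- _; exists a, b, c; split=> //.
by apply/setP=> x; rewrite !inE -!orbA.
Qed.

Lemma cards4_sorted n (A : {set 'I_n}) : #|A| = 4 ->
  exists a b c d : 'I_n, [/\ a < b, b < c, c < d & A = [set a; b; c; d]].
Proof.
rewrite cardE; move: (enum_ord_sorted A) (set_enum A).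
case: (enum A) => [|a [|b [|c [|d []]]]] //= /and4P[ab bc cd _] <- _.
exists a, b, c, d; split=> //.
by apply/setP=> x; rewrite !inE -!orbA.
Qed.

Lemma steiner_fourth (T : {set 'I_10}) : #|T| = 3 ->
  exists2 d, d \notin T /\ steiner (d |: T) &
    forall x, x \notin T -> steiner (x |: T) -> x = d.
Proof.
move=> T3; have [a [b [c [ab bc TE]]]] := cards3_sorted T3.
have := all_fromP (all_fromP (all_fromP blocks_steiner (leq0n a)) ab) bc.
pose new_block d := (d \notin [:: val a; val b; val c]) && has_block [in [:: d; val a; val b; val c]].
rewrite -(card_ord_count 10 new_block) => /cards1P[d dE].
have dP x : (x \in [set d]) = (x \notin T) && steiner (x |: T).
  rewrite -dE inE /new_block; have -> : (val x \notin [:: val a; val b; val c]) = (x \notin T).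
    by rewrite TE !inE -!val_eqE /= -!orbA.
  case: (boolP (x \in T)) => //= xT; rewrite /steiner cardsU1 T3 xT /=.
  by apply: eq_has_block => y; rewrite TE !inE inord_val -!val_eqE /= -!orbA.
exists d; first by apply/andP; rewrite -dP inE.
by move=> x xT xB; apply/set1P; rewrite dP xT.
Qed.

Lemma steiner_large_set (A : {set 'I_10}) : #|A| = 4 ->
  9 <= #|[set i | steiner (relabelling i @: A)]|.
Proof.
move=> A4; have [a [b [c [d [ab bc cd AE]]]]] := cards4_sorted A4.
have := all_fromP (all_fromP (all_fromP (all_fromP blocks_large_set (leq0n a)) ab) bc) cd.
rewrite -card_table; congr (_ <= _); apply: eq_card => i; rewrite !inE /steiner.
rewrite card_imset ?A4 /=; last exact: relabelling_inj.
apply: eq_has_block => x; rewrite AE !imsetU !imset_set1 !inE !inord_val -!val_eqE.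
by rewrite !relabellingE /= !nth_row ?ltn_ord // orbF -!orbA.
Qed.

Lemma bridge_cover_point (a b : 'I_10) : 9 <= #|[set g | bridge g a == b]|.
Proof.
have := all_fromP (all_fromP bridge_nat_point (leq0n a)) (leq0n b).
rewrite -card_table; congr (_ <= _); apply: eq_card => g; rewrite !inE.
by rewrite nth_row ?ltn_ord // -bridgeE.
Qed.

Lemma bridge_cover_pair (A B : {set 'I_10}) : #|A| = 2 -> #|B| = 2 ->
  2 <= #|[set g | bridge g @: A == B]|.
Proof.
move=> /cards2_sorted[a [b [ab ->]]] /cards2_sorted[c [d [cd ->]]].
have := all_fromP (all_fromP (all_fromP (all_fromP bridge_nat_pair (leq0n a)) ab) (leq0n c)) cd.
rewrite -card_table => /leq_trans-> //; apply/subset_leq_card/subsetP=> g.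
rewrite !inE !nth_row ?ltn_ord // -!bridgeE /= !eqnE !(inj_eq val_inj) !imsetU !imset_set1.
case: eqP => [->|_]; first by move/eqP->.
by case: eqP => // -> /eqP->; rewrite setUC.
Qed.

(** The standard one-factorisation of the complete graph on ten points: a + b modulo 9 for finite
    points, and 2 * a for the edge from a to the point 9; the latter is 2 * (a + 9) modulo 9, which
    puts both cases in one formula. *)
Definition edge_colour (A : {set 'I_10}) := ((ord_max \in A).+1 * \sum_(x in A) x) %% 9.

Lemma edge_colour_table : all_from 0 (fun a => all_from 0 (fun x => all_from 0 (fun y =>
  [|| x == a, y == a, x == y |
     (((9 == x) || (9 == a)).+1 * (x + a)) %% 9 != (((9 == y) || (9 == a)).+1 * (y + a)) %% 9]))).
Proof. by vm_compute. Qed.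

Lemma edge_colour_packing (T : {set 'I_10}) x y : #|T| = 1 -> x \notin T -> y \notin T ->
  edge_colour (x |: T) = edge_colour (y |: T) -> x = y.
Proof.
move=> /eqP/cards1P[a ->]; rewrite !inE => xa ya.
rewrite /edge_colour !big_setU1 ?inE // !big_set1 -!val_eqE /= => eq_xy.
have := all_fromP (all_fromP (all_fromP edge_colour_table (leq0n a)) (leq0n x)) (leq0n y).
by rewrite eq_xy eqxx !val_eqE (negPf xa) (negPf ya) orbF => /eqP.
Qed.

(** For 3 + 1 points it is the single point that is transported to the other level: were the three
    points transported, the number of systems containing them would depend on how the bijections
    act on triples. *)
Definition mixed_block g (A B : {set 'I_10}) :=
  [|| (#|A| == 3) && [exists b, (B == [set bridge g b]) && steiner (b |: A)],
      (#|B| == 3) && [exists a, (A == [set a]) && steiner (bridge g a |: B)]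
    | (#|A| == 2) && (bridge g @: A == B)].

Lemma steiner_packing (T : {set 'I_10}) x y : #|T| = 3 ->
  x \notin T -> y \notin T -> steiner (x |: T) -> steiner (y |: T) -> x = y.
Proof. by move=> /steiner_fourth[d _ dP] xT yT /(dP x xT)-> /(dP y yT)->. Qed.

(** The form in which [steiner_packing] is met below: the point z comes from the opposite level. *)
Lemma steiner_packing_pair (T : {set 'I_10}) z x y : #|T| = 2 ->
  x \notin T -> y \notin T -> steiner (z |: (x |: T)) -> steiner (z |: (y |: T)) -> x = y.
Proof.
move=> T2 xT yT bx bY.
have zP w : w \notin T -> steiner (z |: (w |: T)) -> z \notin w |: T.
  by move=> wT /andP[+ _]; rewrite !cardsU1 wT T2; case: (z \notin _).
have:= zP x xT bx; have := zP y yT bY; rewrite !inE !negb_or => /andP[zy zT] /andP[zx _].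
apply: (@steiner_packing (z |: T)); rewrite ?cardsU1 ?zT ?T2 // ?inE ?negb_or.
- by rewrite eq_sym zx.
- by rewrite eq_sym zy.
- by rewrite setUCA.
- by rewrite setUCA.
Qed.

Lemma setU1_inj (T : finType) (A : {set T}) x y :
  x \notin A -> x |: A = y |: A -> x = y.
Proof.
move=> xA eq_xy; have := setU11 x A; rewrite eq_xy inE (negPf xA) orbF.
by move/set1P.
Qed.

(** With [side s x A] and [side (~~ s) x B] on the two levels, both positions of the fourth point x
    of a quadruple through a given triple are treated at once. *)
Definition side (s : bool) (x : 'I_10) (T : {set 'I_10}) := if s then x |: T else T.

(** Within one kind of block this is the packing property of the Steiner system or injectivity of
    [bridge g].  The kinds exclude each other: a 3 + 1 block and a pair block through the same three
    points would make two points of a Steiner block coincide. *)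
Lemma mixed_block_packing g (A B : {set 'I_10}) s t x y : #|A| + #|B| = 3 ->
  x \notin (if s then A else B) -> y \notin (if t then A else B) ->
  mixed_block g (side s x A) (side (~~ s) x B) ->
  mixed_block g (side t y A) (side (~~ t) y B) -> s = t /\ x = y.
Proof.
have noblock z w (T : {set 'I_10}) : z \in T -> #|T| = 2 -> steiner (z |: (w |: T)) -> False.
  move=> zT T2 /andP[+ _]; rewrite cardsU1 inE zT orbT /= cardsU1 T2.
  by case: (w \notin T).
rewrite /mixed_block; case Ak: #|A| => [|[|[|[|k]]]] // ABk.
- have Bk : #|B| = 3 by [].
  have /cards0_eq-> := Ak.
  have mb (r : bool) z : z \notin (if r then set0 else B) ->
      mixed_block g (side r z set0) (side (~~ r) z B) -> r /\ steiner (bridge g z |: B).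
    case: r => /= zN; rewrite /mixed_block ?setU0 ?cardsU1 ?zN ?cards0 ?cards1 ?Bk //= orbF.
    by case/existsP=> a /andP[/eqP/set1_inj->].
  move=> xN yN /(mb _ _ xN)[sT bx] /(mb _ _ yN)[tT bY]; rewrite sT tT; split=> //.
  have gN z : steiner (bridge g z |: B) -> bridge g z \notin B.
    by move=> /andP[+ _]; rewrite cardsU1 Bk; case: (_ \notin B).
  apply: (@bridge_inj g); apply: (steiner_packing Bk) => //; exact: gN.
- have Bk : #|B| = 2 by case: ABk.
  have /eqP/cards1P[a AE] := Ak; rewrite AE in Ak *.
  have mb (r : bool) z : z \notin (if r then [set a] else B) ->
      mixed_block g (side r z [set a]) (side (~~ r) z B) ->
      if r then bridge g @: (z |: [set a]) = B else steiner (bridge g a |: (z |: B)).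
    case: r => /= zN; rewrite /mixed_block !cardsU1 zN ?cards1 Bk //=.
      by move/eqP.
    by rewrite orbF => /existsP[a' /andP[/eqP/set1_inj->]].
  move=> xN yN /(mb _ _ xN) + /(mb _ _ yN).
  case: s t xN yN => [] [] xN yN bx bY.
  + split=> //; apply: (setU1_inj xN); apply: (imset_inj (@bridge_inj g)).
    by rewrite bx bY.
  + by case: (noblock _ _ _ _ Bk bY); rewrite -bx imset_f // !inE eqxx orbT.
  + by case: (noblock _ _ _ _ Bk bx); rewrite -bY imset_f // !inE eqxx orbT.
  + by split=> //; apply: (steiner_packing_pair Bk xN yN bx bY).
- have Bk : #|B| = 1 by case: ABk.
  have /eqP/cards1P[c BE] := Bk; rewrite BE in Bk *.
  have mb (r : bool) z : z \notin (if r then A else [set c]) ->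
      mixed_block g (side r z A) (side (~~ r) z [set c]) ->
      if r then exists2 b, bridge g b = c & steiner (b |: (z |: A))
      else bridge g @: A = z |: [set c].
    case: r => /= zN; rewrite /mixed_block !cardsU1 zN ?cards1 Ak //=.
      by rewrite orbF => /existsP[b /andP[/eqP/set1_inj-> bb]]; exists b.
    by move/eqP.
  move=> xN yN /(mb _ _ xN) + /(mb _ _ yN).
  have cA z : bridge g @: A = z |: [set c] -> forall b, bridge g b = c -> b \in A.
    move=> gA b gb; have : c \in bridge g @: A by rewrite gA !inE eqxx orbT.
    by rewrite -gb mem_imset //; exact: bridge_inj.
  case: s t xN yN => [] [] xN yN.
  + move=> [b gb bx] [b' gb' bY]; split=> //.
    have eb : b = b' by apply: (@bridge_inj g); rewrite gb gb'.
    by rewrite -eb in bY; apply: (steiner_packing_pair Ak xN yN bx bY).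
  + move=> [b gb bx] /cA/(_ b gb) bA; by case: (noblock _ _ _ bA Ak bx).
  + move=> /cA gA [b gb bY]; by case: (noblock _ _ _ (gA b gb) Ak bY).
  + by move=> gx gy; split=> //; apply: (setU1_inj xN); rewrite -gx.
- have /cards0_eq-> : #|B| = 0 by case: ABk.
  have mb (r : bool) z : z \notin (if r then A else set0) ->
      mixed_block g (side r z A) (side (~~ r) z set0) ->
      ~~ r /\ exists2 b, bridge g b = z & steiner (b |: A).
    case: r => /= zN; rewrite /mixed_block ?setU0 ?cardsU1 ?zN ?cards0 ?cards1 ?Ak //= orbF.
    by case/existsP=> b /andP[/eqP/set1_inj-> bb]; split=> //; exists b.
  move=> xN yN /(mb _ _ xN)[sF [b gb bx]] /(mb _ _ yN)[tF [b' gb' bY]].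
  rewrite (negPf sF) (negPf tF); split=> //; rewrite -gb -gb'; congr (bridge g _).
  have bN z : steiner (z |: A) -> z \notin A.
    by move=> /andP[+ _]; rewrite cardsU1 Ak; case: (_ \notin A).
  by apply: (steiner_packing Ak) => //; exact: bN.
Qed.

Lemma mixed_block_cover31 (A B : {set 'I_10}) : #|A| = 3 -> #|B| = 1 ->
  9 <= #|[set g | mixed_block g A B]|.
Proof.
move=> A3 B1; have /eqP/cards1P[c ->] := B1; have [d [_ bd] _] := steiner_fourth A3.
apply: leq_trans (bridge_cover_point d c) (subset_leq_card _).
apply/subsetP=> g; rewrite !inE => /eqP gd; apply/orP; left; rewrite A3 /=.
by apply/existsP; exists d; rewrite gd eqxx.
Qed.

Lemma mixed_block_cover13 (A B : {set 'I_10}) : #|A| = 1 -> #|B| = 3 ->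
  9 <= #|[set g | mixed_block g A B]|.
Proof.
move=> A1 B3; have /eqP/cards1P[a ->] := A1; have [d [_ bd] _] := steiner_fourth B3.
apply: leq_trans (bridge_cover_point a d) (subset_leq_card _).
apply/subsetP=> g; rewrite !inE => /eqP gd; apply/orP; right; rewrite B3 /=.
by apply/orP; left; apply/existsP; exists a; rewrite gd eqxx.
Qed.

Lemma mixed_block_cover22 (A B : {set 'I_10}) : #|A| = 2 -> #|B| = 2 ->
  2 <= #|[set g | mixed_block g A B]|.
Proof.
move=> A2 B2; apply: leq_trans (bridge_cover_pair A2 B2) (subset_leq_card _).
by apply/subsetP=> g; rewrite !inE /mixed_block A2 B2 => ->.
Qed.

Definition pair_block (i : 'I_63) (A B : {set 'I_10}) :=
  [&& #|A| == 2, #|B| == 2 & (edge_colour A + edge_colour B) %% 9 == i %% 9].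

Lemma pair_block_cover (A B : {set 'I_10}) : #|A| = 2 -> #|B| = 2 ->
  7 <= #|[set i | pair_block i A B]|.
Proof.
move=> A2 B2; have : all (fun k => 7 <= count (fun i => k == i %% 9) (iota 0 63)) (iota 0 9) by [].
move=> /allP/(_ ((edge_colour A + edge_colour B) %% 9)); rewrite mem_iota ltn_mod => /(_ isT).
rewrite -card_ord_count => /leq_trans-> //; apply: subset_leq_card.
by apply/subsetP=> i; rewrite !inE /pair_block A2 B2.
Qed.

Lemma pair_block_packing i (A B : {set 'I_10}) s t x y : #|A| + #|B| = 3 ->
  x \notin (if s then A else B) -> y \notin (if t then A else B) ->
  pair_block i (side s x A) (side (~~ s) x B) ->
  pair_block i (side t y A) (side (~~ t) y B) -> s = t /\ x = y.
Proof.
have kap_cancel a b c : (a < 9) -> (b < 9) -> (a + c) %% 9 = (b + c) %% 9 -> a = b.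
  by move=> a9 b9 /eqP; rewrite eqn_modDr !modn_small // => /eqP.
have kap9 T : edge_colour T < 9 by rewrite ltn_mod.
move=> AB3 xN yN /and3P[/eqP Ax /eqP Bx /eqP kx] /and3P[/eqP Ay /eqP By /eqP ky].
have st : s = t.
  clear -Ax Ay xN yN; case: s t xN yN Ax Ay => [] [] //= xN yN; rewrite cardsU1 ?xN ?yN.
    by move=> A1 A2; rewrite A2 in A1.
  by move=> A1 A2; rewrite A1 in A2.
case: t / st yN Ay By ky => yN Ay By ky; split=> //.
case: s xN yN Ax Bx kx Ay By ky => /= xN yN Ax Bx kx Ay By ky.
  apply: (@edge_colour_packing A) => //; first by move: Ax; rewrite cardsU1 xN => -[].
  by apply: (@kap_cancel _ _ (edge_colour B)); rewrite ?kap9 // kx.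
apply: (@edge_colour_packing B) => //; first by move: Bx; rewrite cardsU1 xN => -[].
by apply: (@kap_cancel _ _ (edge_colour A)); rewrite ?kap9 // ![_ + edge_colour A]addnC kx.
Qed.

(** * Colours of quadruples on at least three levels *)
Lemma cards3_uniq (T : finType) (A : {set T}) : #|A| = 3 ->
  exists a b c, [/\ a != b, a != c, b != c & A = [set a; b; c]].
Proof.
rewrite cardE; move: (enum_uniq A) (set_enum A).
case: (enum A) => [|a [|b [|c []]]] //=; rewrite !inE negb_or andbT.
move=> /andP[/andP[ab ac] bc] <- _; exists a, b, c; split=> //.
by apply/setP=> x; rewrite !inE -!orbA.
Qed.

Lemma not_injective_pair (A B : finType) (f : A -> B) (D : {set A}) :
  #|f @: D| != #|D| -> exists x y, [/\ x \in D, y \in D, x != y & f x = f y].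
Proof.
move=> /imset_injP not_inj.
case: (boolP [exists x in D, exists y in D, (x != y) && (f x == f y)]).
  by move=> /exists_inP[x xD /exists_inP[y yD /andP[xy /eqP fxy]]]; exists x, y.
move=> no_pair; case: not_inj => x y xD yD fxy; apply: contraNeq no_pair => xy.
by apply/exists_inP; exists x => //; apply/exists_inP; exists y; rewrite ?xy ?fxy /=.
Qed.

Lemma triple_inj (A B C : Type) (a a' : A) (b b' : B) (c c' : C) :
  (a, (b, c)) = (a', (b', c')) -> [/\ a = a', b = b' & c = c'].
Proof. by case. Qed.

(** The left-hand side is the label of the codeword (a, b, c, d) for the linear form (p, q, r, s);
    the right-hand side is the label of the codeword with a replaced by the midpoint of a and m,
    where the second coordinate is eliminated by the equation a + b + c + d = constant. *)
Lemma midpoint_cancel (F : fieldType) (p q r s a b c d m : F) : (2%:R != 0 :> F)%R -> p != q ->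
  (q * b + (p * a + (r * c + s * d)) =
   (p - q) / 2%:R * m + ((p - q) / 2%:R * a + ((r - q) / 1 * c + (s - q) / 1 * d)) +
   q * (b + (a + (c + d))))%R -> a = m.
Proof.
move=> two_neq0 pq eq_lab; apply/eqP; rewrite -subr_eq0.
have : ((p - q) * (a - m) == 0)%R.
  have -> : ((p - q) * (a - m) = 2%:R * (q * b + (p * a + (r * c + s * d)) -
    ((p - q) / 2%:R * m + ((p - q) / 2%:R * a + ((r - q) / 1 * c + (s - q) / 1 * d)) +
   q * (b + (a + (c + d))))))%R. by field; rewrite oner_neq0.
  by rewrite eq_lab subrr mulr0.
by rewrite mulf_eq0 !subr_eq0 (negPf pq).
Qed.
Lemma F2_cancel (a b c d m : 'F_2) : (b + (a + (c + d)) = 0)%R ->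
  (b + a = m + (a + (c + d)))%R \/ (c + d = m + (a + (c + d)))%R -> a = m.
Proof.
have addzz (z : 'F_2) : (z + z = 0)%R by rewrite -mulr2n; case: z => [[|[|]]] //= i; apply: val_inj.
have eqz (z t : 'F_2) : (z + t = 0 -> z = t)%R.
  by move=> zt; rewrite -[z]addr0 -(addzz t) addrA zt add0r.
move=> sum0 [] eq_lab; apply: eqz.
  have -> : (a + m = (b + a + (m + (a + (c + d)))) - (b + (a + (c + d))) )%R by ring.
  by rewrite -eq_lab addzz sum0 subrr.
have -> : (a + m = m + (a + (c + d)) - (c + d))%R by ring.
by rewrite -eq_lab subrr.
Qed.

Section Levels.

Variable V : finZmodType.
Hypothesis addvv : forall v : V, (v + v = 0)%R.

Local Notation X := ('I_10 * V)%type.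
Implicit Types (Q T : {set X}) (L : {set V}) (u v w : V) (x y : X).

Definition levels Q := [set x.2 | x in Q].
Definition layer Q u := [set y | (y, u) \in Q].
Definition level_sum Q := (\sum_(x in Q) x.2)%R.

Lemma levels_add x T : levels (x |: T) = x.2 |: levels T.
Proof. exact: imsetU1. Qed.

Lemma layer_add x T u : layer (x |: T) u = if x.2 == u then x.1 |: layer T u else layer T u.
Proof.
apply/setP=> y; case: x => z v /=; case: eqP => [<-|neq]; rewrite !inE xpair_eqE ?eqxx ?andbT //.
have -> : (u == v) = false by apply/eqP=> uv; case: neq.
by rewrite andbF.
Qed.

Lemma layer_notin x T : x \notin T -> x.1 \notin layer T x.2.
Proof. by move=> xT; rewrite inE -surjective_pairing. Qed.

Lemma card_layer_add x T u : x \notin T -> #|layer (x |: T) u| = (x.2 == u) + #|layer T u|.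
Proof.
by move=> xT; rewrite layer_add; case: eqP => // <-; rewrite cardsU1 layer_notin.
Qed.

Lemma layer_gt0 Q u : (0 < #|layer Q u|) = (u \in levels Q).
Proof.
apply/card_gt0P/imsetP=> [[y]|[[y u'] yQ /= ->]]; last by exists y; rewrite inE.
by rewrite inE => yQ; exists (y, u).
Qed.

Lemma card_layerE Q u : #|layer Q u| = #|[set x in Q | x.2 == u]|.
Proof.
have inj_u : injective (fun a : 'I_10 => (a, u)) by move=> a b [].
rewrite -(card_imset _ inj_u).
apply: eq_card => -[y v]; rewrite !inE /=; apply/imsetP/andP => [[z]|[yQ /eqP<-]].
  by rewrite inE => zQ [-> ->].
by exists y => //; rewrite inE.
Qed.

Lemma card_layers Q : \sum_(u in levels Q) #|layer Q u| = #|Q|.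
Proof.
rewrite -sum1_card (partition_big (fun x => x.2) (mem (levels Q))) /=; last first.
  by move=> x xQ; apply: imset_f.
apply: eq_bigr => u _; rewrite card_layerE -sum1_card.
by apply: eq_bigl => x; rewrite inE.
Qed.

Lemma level_sum_add x T : x \notin T -> level_sum (x |: T) = (x.2 + level_sum T)%R.
Proof. by move=> xT; rewrite /level_sum big_setU1. Qed.

Lemma oppv v : (- v = v)%R.
Proof. by apply/eqP; rewrite eq_sym -subr_eq0 opprK addvv. Qed.

Lemma addvK v w : (v + (v + w) = w)%R.
Proof. by rewrite addrA addvv add0r. Qed.

Lemma addv_eq0 v w : ((v + w == 0) = (v == w))%R.
Proof. by rewrite -[w in LHS]oppv subr_eq0. Qed.

Definition sumv L := (\sum_(u in L) u)%R.

Lemma sumv3 u v w : u != v -> u != w -> v != w -> sumv [set u; v; w] = (u + v + w)%R.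
Proof.
move=> uv uw vw; rewrite /sumv setUC big_setU1 ?big_setU1 ?big_set1 ?inE ?negb_or //=.
  by rewrite addrC.
by rewrite eq_sym uw eq_sym vw.
Qed.

Lemma sumv3_notin L : #|L| = 3 -> sumv L \notin L.
Proof.
move=> /cards3_uniq[u [v [w [uv uw vw ->]]]]; rewrite sumv3 // !inE !negb_or.
have neq (a b c : V) : b != c -> (a + (b + c) != a)%R.
  by move=> bc; rewrite -{2}[a]addr0 (inj_eq (addrI a)) addv_eq0.
rewrite -andbA; apply/and3P; split.
- by rewrite -addrA neq.
- by rewrite -addrA addrCA neq.
- by rewrite addrC neq.
Qed.

(** Three levels are completed to the affine plane that they span. *)
Definition plane L := if #|L| == 3 then sumv L |: L else L.

Lemma plane3 L : #|L| = 3 -> plane L = sumv L |: L.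
Proof. by rewrite /plane => ->. Qed.

Lemma plane4 L : #|L| = 4 -> plane L = L.
Proof. by rewrite /plane => ->. Qed.

Lemma card_plane L : 3 <= #|L| <= 4 -> #|plane L| = 4.
Proof.
rewrite /plane; case: (eqVneq #|L| 3) => [L3 _|]; first by rewrite cardsU1 sumv3_notin ?L3.
by case: #|L| => [|[|[|[|[|]]]]].
Qed.

(** The corners of a plane are numbered 0, 1, 2, 3, in the arbitrary order of the enumeration. The
    numbers serve twice: as the coefficients, distinct modulo 5, of the linear form that labels
    codewords, and to number the direction of the plane from corner 0 to corner k by k. *)
Definition corner L i := nth 0%R (enum (plane L)) i.
Definition rank L u : 'F_5 := ((index u (enum (plane L)))%:R)%R.

Lemma natrF5_inj i j : i < 5 -> j < 5 -> (i%:R = j%:R :> 'F_5)%R -> i = j.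
Proof.
move=> i5 j5 /(congr1 val); rewrite /= !val_Fp_nat //.
by rewrite !modn_small.
Qed.

Lemma rank_inj L : 3 <= #|L| <= 4 -> {in plane L &, injective (rank L)}.
Proof.
move=> /card_plane L4 u v uL vL /natrF5_inj.
have lt_index z : z \in plane L -> index z (enum (plane L)) < 5.
  by move=> zL; rewrite ltnS -L4 cardE index_size.
move=> /(_ (lt_index u uL) (lt_index v vL)) /(congr1 (corner L)).
by rewrite /corner !nth_index ?mem_enum.
Qed.

Lemma rank_corner L i : 3 <= #|L| <= 4 -> i < 4 -> rank L (corner L i) = (i%:R)%R.
Proof. by move=> /card_plane L4 i4; rewrite /rank index_uniq ?enum_uniq // -cardE L4. Qed.

Lemma corner_in L i : 3 <= #|L| <= 4 -> i < 4 -> corner L i \in plane L.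
Proof. by move=> /card_plane L4 i4; rewrite -mem_enum mem_nth // -cardE L4. Qed.

Lemma corner_eq L i j : 3 <= #|L| <= 4 -> i < 4 -> j < 4 -> (corner L i == corner L j) = (i == j).
Proof. by move=> /card_plane L4 i4 j4; rewrite nth_uniq ?enum_uniq // -cardE L4. Qed.

Definition residues (n : nat) : 'F_5 * 'F_2 := (n%:R, n%:R)%R.
Definition res5 x : 'F_5 := ((x.1 : nat)%:R)%R.
Definition res2 x : 'F_2 := ((x.1 : nat)%:R)%R.

Lemma point_eq x y : x.2 = y.2 -> res5 x = res5 y -> res2 x = res2 y -> x = y.
Proof.
case: x y => [a u] [b v] /= -> /(congr1 val) + /(congr1 val).
rewrite /= !val_Fp_nat // => m5 m2; congr (_, _); apply/val_inj/eqP => /=.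
rewrite -(modn_small (ltn_ord a)) -(modn_small (ltn_ord b)).
by rewrite (chinese_remainder (isT : coprime 5 2)) m5 m2 !eqxx.
Qed.

(** On levels u, u, v, w the label is that of the codeword with the midpoint on level u.  Its
    coordinate on the missing level r equals the code constant minus the other coordinates, so
    each coefficient is lowered by that of r, and r contributes its own coefficient times the
    constant; taking the midpoint divides by the number of points on the level. *)
Definition weight Q u : 'F_5 :=
  ((rank (levels Q) u - rank (levels Q) (sumv (levels Q))) / #|layer Q u|%:R)%R.

Definition label3 Q : 'F_5 :=
  (\sum_(x in Q) weight Q x.2 * res5 x +
   rank (levels Q) (sumv (levels Q)) * rank (levels Q) (corner (levels Q) 0 + level_sum Q))%R.

Definition tot5 Q := (\sum_(x in Q) res5 x)%R.
Definition tot2 Q := (\sum_(x in Q) res2 x)%R.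
Definition label5 Q := (\sum_(x in Q) rank (levels Q) x.2 * res5 x)%R.
Definition label2 Q u v := (\sum_(x in Q | (x.2 == u) || (x.2 == v)) res2 x)%R.

(** For four distinct levels with sum 0: the code of constant (k, 0) in Z_5 x Z_2, k = 1, 2, 3,
    belongs to the direction from corner 0 to corner k; the value 0 stands for the other seven. *)
Definition code_index Q := if (tot2 Q == 0)%R && (tot5 Q < 4) then nat_of_ord (tot5 Q) else 0.

(** In the last case the second label is the sum along one side of direction u + v; the parallel
    side has the same sum, because the total is 0 in Z_2. *)
Definition coarse Q : V * ('F_5 * 'F_2) :=
  let L := levels Q in
  if #|L| == 3 then (level_sum Q, (label3 Q, tot2 Q))
  else if (level_sum Q != 0)%R then (level_sum Q, (tot5 Q, tot2 Q))
  else if code_index Q == 0 then (0%R, (tot5 Q, tot2 Q))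
  else let u := corner L 0 in let v := corner L (code_index Q) in
    ((u + v)%R, (label5 Q, label2 Q u v)).

Lemma code_index_lt4 Q : code_index Q < 4.
Proof. by rewrite /code_index; case: ifP => // /andP[]. Qed.

Lemma code_indexP Q : code_index Q != 0 -> tot5 Q = (code_index Q)%:R%R /\ tot2 Q = 0%R.
Proof. by rewrite /code_index; case: ifP => // /andP[/eqP-> _] _; rewrite natr_Zp. Qed.

Lemma card_levels Q : #|levels Q| <= #|Q|.
Proof. exact: leq_imset_card. Qed.

Lemma levels_bounds x T : #|T| = 3 -> x \notin T ->
  2 < #|levels (x |: T)| -> 3 <= #|levels (x |: T)| <= 4.
Proof.
move=> T3 xT ->; apply: leq_trans (card_levels _) _.
by rewrite cardsU1 xT T3.
Qed.

Lemma sumv_in_plane L : #|L| = 3 -> sumv L \in plane L.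
Proof. by move=> L3; rewrite plane3 // setU11. Qed.

Lemma sub_plane L : L \subset plane L.
Proof. by rewrite /plane; case: ifP => // _; exact: subsetUr. Qed.

Lemma weight_neq0 Q u : #|Q| = 4 -> #|levels Q| = 3 -> u \in levels Q -> (weight Q u != 0)%R.
Proof.
move=> Q4 L3 uL; rewrite mulf_eq0 invr_eq0 negb_or subr_eq0; apply/andP; split.
  apply: contraNneq (sumv3_notin L3) => /rank_inj <- //; rewrite ?L3 //.
    exact: subsetP (sub_plane _) _ _.
  exact: sumv_in_plane.
have fib4 : #|layer Q u| < 5.
  have : #|layer Q u| <= #|Q|.
    by rewrite card_layerE; apply/subset_leq_card/subsetP=> x; rewrite inE => /andP[].
  by rewrite Q4.
apply/eqP=> /(@natrF5_inj _ 0 fib4 isT) fib0.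
by move: uL; rewrite -layer_gt0 fib0.
Qed.

(** Two quadruples that differ in one point and use the same levels are coloured by the same linear
    form, and the coefficient of the new point is invertible. *)
Lemma coarse_packing_level T x y : #|T| = 3 -> x \notin T -> y \notin T ->
  x.2 = y.2 -> 2 < #|levels (x |: T)| -> coarse (x |: T) = coarse (y |: T) -> x = y.
Proof.
move=> T3 xT yT xy2 /(levels_bounds T3 xT) L34.
have Q4 : #|x |: T| = 4 by rewrite cardsU1 xT T3.
have eqL : levels (y |: T) = levels (x |: T) by rewrite !levels_add xy2.
have eqS : level_sum (y |: T) = level_sum (x |: T) by rewrite !level_sum_add // xy2.
have eq5 : tot5 (x |: T) = tot5 (y |: T) -> res5 x = res5 y.
  by rewrite /tot5 !big_setU1 //= => /addIr.
have eq2 : tot2 (x |: T) = tot2 (y |: T) -> res2 x = res2 y.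
  by rewrite /tot2 !big_setU1 //= => /addIr.
have xL : x.2 \in levels (x |: T) by rewrite levels_add setU11.
rewrite /coarse eqL eqS; case: (eqVneq #|levels (x |: T)| 3) => [L3|_].
  rewrite /= => eq_c; have [_ + /eq2 e2] := triple_inj eq_c.
  rewrite /label3 eqL eqS => /addIr lab; apply: point_eq => //.
  move: lab.
  have eqW u : weight (y |: T) u = weight (x |: T) u.
    by rewrite /weight eqL !card_layer_add // xy2.
  under [X in _ = X]eq_bigr => z _ do rewrite eqW.
  rewrite !big_setU1 //= => /addIr; rewrite -xy2; apply: mulfI.
  exact: weight_neq0.
rewrite /=; case: ifP => _.
  by move=> eq_c; have [_ /eq5 e5 /eq2 e2] := triple_inj eq_c; apply: point_eq.
have corner_neq Q : code_index Q != 0 ->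
    (corner (levels (x |: T)) 0 + corner (levels (x |: T)) (code_index Q) == 0)%R = false.
  move=> k0; rewrite addv_eq0 corner_eq ?code_index_lt4 //.
  by rewrite eq_sym (negPf k0).
case: (eqVneq (code_index (x |: T)) 0) => [_|kx]; case: (eqVneq (code_index (y |: T)) 0) => [_|ky].
- by move=> eq_c; have [_ /eq5 e5 /eq2 e2] := triple_inj eq_c; apply: point_eq.
- by move=> eq_c; have [/esym/eqP + _ _] := triple_inj eq_c; rewrite corner_neq.
- by move=> eq_c; have [/eqP + _ _] := triple_inj eq_c; rewrite corner_neq.
move=> eq_c; have [/addrI/eqP + _ _] := triple_inj eq_c.
rewrite corner_eq ?code_index_lt4 // => /eqP eqk.
have [x5 x2] := code_indexP kx; have [y5 y2] := code_indexP ky.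
by apply: point_eq => //; [apply: eq5; rewrite x5 y5 eqk | apply: eq2; rewrite x2 y2].
Qed.

(** The quadruples whose direction is the sum of their levels. *)
Definition ordinary Q := (#|levels Q| == 3) || (level_sum Q != 0)%R.

Lemma coarse_ordinary Q : ordinary Q -> (coarse Q).1 = level_sum Q.
Proof. by rewrite /ordinary /coarse; case: ifP => //= _ ->. Qed.

Lemma cards_pair_setU (Z : finType) (A : {set Z}) a b : a \in A -> b \in A -> a != b ->
  #|A| = 4 -> exists c d,
    [/\ a \notin b |: [set c; d], b \notin [set c; d], c != d & A = a |: (b |: [set c; d])].
Proof.
move=> aA bA ab A4; have : #|(A :\ a) :\ b| == 2.
  have := cardsD1 a A; have := cardsD1 b (A :\ a); rewrite aA A4 !inE eq_sym ab bA.
  by case: #|(A :\ a) :\ b| => [|[|[|k]]] // -> .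
move=> /cards2P[c [d [cd AE]]].
have aN : a \notin [set c; d] by rewrite -AE !inE eqxx andbF.
have bN : b \notin [set c; d] by rewrite -AE !inE eqxx.
exists c, d; split=> //.
  by rewrite in_setU1 negb_or ab.
by rewrite -AE setD1K ?setD1K // !inE eq_sym ab.
Qed.

(** The repeated level cancels, and the other two levels are distinct. *)
Lemma level_sum3_neq0 Q : #|Q| = 4 -> #|levels Q| = 3 -> level_sum Q != 0%R.
Proof.
move=> Q4 L3.
have [x [y [xQ yQ xy xy2]]] : exists x y, [/\ x \in Q, y \in Q, x != y & x.2 = y.2].
  by apply: not_injective_pair; rewrite -/(levels Q) L3 Q4.
have [z [t [xN yN zt QE]]] := cards_pair_setU xQ yQ xy Q4.
have levE : levels Q = y.2 |: [set z.2; t.2].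
  by rewrite QE !levels_add xy2 setUA setUid /levels imset_set1.
have zt2 : z.2 != t.2.
  apply: contra_eqN L3 => /eqP eq_zt; rewrite levE eq_zt setUid cardsU1 cards1.
  by case: (_ \notin _).
rewrite QE level_sum_add // level_sum_add // addrA xy2 addvv add0r.
rewrite level_sum_add ?inE // /level_sum big_set1 addv_eq0.
exact: zt2.
Qed.

Lemma ordinary_neq0 Q : #|Q| = 4 -> ordinary Q -> level_sum Q != 0%R.
Proof. by move=> Q4 /orP[/eqP/(level_sum3_neq0 Q4)|]. Qed.

Lemma plane_closed L u v w : #|L| = 4 -> sumv L = 0%R -> u \in L -> v \in L -> w \in L ->
  u != v -> (w + (u + v))%R \in L.
Proof.
move=> L4 L0 uL vL wL uv.
have [c [d [uN vN cd LE]]] := cards_pair_setU uL vL uv L4.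
move: L0; rewrite {1}LE /sumv (big_setU1 u) // (big_setU1 v) // (big_setU1 c) ?big_set1 ?inE //=.
rewrite addrA => /eqP; rewrite addv_eq0 => /eqP uvE.
move: wL; rewrite LE !inE => /or4P[] /eqP->.
- by rewrite addvK eqxx !orbT.
- by rewrite addrCA addvv addr0 eqxx.
- by rewrite uvE addvK eqxx !orbT.
- by rewrite uvE addrCA addvv addr0 eqxx !orbT.
Qed.

(** Here the first quadruple, of level sum 0, is a codeword with its new point on the fourth corner
    of a plane, and the equality of directions forces the new point y of the second one onto the
    level of a point a of T.  Equality of labels then makes a the midpoint of a and y modulo 5 and
    gives a = y modulo 2, so y lies in T. *)
Lemma coarse_mixed T x y : #|T| = 3 -> x \notin T -> y \notin T ->
  ~~ ordinary (x |: T) -> ordinary (y |: T) -> 2 < #|levels (x |: T)| ->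
  coarse (x |: T) <> coarse (y |: T).
Proof.
move=> T3 xT yT; rewrite negb_or negbK => /andP[L3 /eqP sgx] ordy L34 eq_c.
(* T lies on three distinct levels and x on the fourth corner of their plane. *)
have {L3 L34} L4 : #|levels (x |: T)| = 4.
  by move: (levels_bounds T3 xT L34) L3; case: #|_| => [|[|[|[|[|]]]]].
have T3' : #|levels T| <= 3 by rewrite -T3; exact: leq_imset_card.
have [xL levT3] : x.2 \notin levels T /\ #|levels T| = 3.
  move: L4 T3'; rewrite levels_add cardsU1; case: (x.2 \in _) => /=.
    by case: #|_| => [|[|[|[|]]]].
  by case.
have injT : {in T &, injective snd} by apply/imset_injP; rewrite -/(levels T) levT3 T3.
have xE : x.2 = sumv (levels T).
  move: sgx; rewrite level_sum_add // => /eqP; rewrite addv_eq0 => /eqP->.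
  by rewrite /sumv /levels big_imset.
have Ly4 : #|y |: T| = 4 by rewrite cardsU1 yT T3.
have sgy0 := ordinary_neq0 Ly4 ordy; have sgyE := coarse_ordinary ordy.
have planeT : plane (levels T) = levels (x |: T) by rewrite plane3 // levels_add xE.
have planeX : plane (levels (x |: T)) = levels (x |: T) by rewrite plane4.
have bX : 3 <= #|levels (x |: T)| <= 4 by rewrite L4.
have bT : 3 <= #|levels T| <= 4 by rewrite levT3.
have rankE : rank (levels (x |: T)) =1 rank (levels T) by move=> w; rewrite /rank planeX planeT.
have cornerE : corner (levels (x |: T)) =1 corner (levels T).
  by move=> k; rewrite /corner planeX planeT.
move: eq_c; rewrite {1}/coarse L4 sgx eqxx /=.
case: (eqVneq (code_index (x |: T)) 0) => [_ eq_c|k0 eq_c].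
  by case/negP: sgy0; rewrite -sgyE -eq_c.
have [tot5E tot2E] := code_indexP k0; have k4 := code_index_lt4 (x |: T).
move: eq_c; rewrite !cornerE; set k := code_index _ in k0 k4 tot5E *.
set u := corner _ 0; set v := corner _ k => eq_c.
have uL : u \in levels (x |: T) by rewrite -planeT corner_in.
have vL : v \in levels (x |: T) by rewrite -planeT corner_in.
have uv : u != v by rewrite corner_eq // eq_sym.
have uvE : (u + v)%R = level_sum (y |: T) by rewrite -sgyE -eq_c.
(* The direction u + v leads from the level of x to that of y, so inside the plane. *)
have yE : y.2 = (x.2 + (u + v))%R.
  rewrite uvE level_sum_add // (addrC y.2) addrA; move: sgx; rewrite level_sum_add // => ->.
  by rewrite add0r.
have yL : y.2 \in levels T.
  have : y.2 \in levels (x |: T).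
    rewrite yE; apply: plane_closed => //; last by rewrite levels_add setU11.
    by rewrite levels_add /sumv big_setU1 //= -/(sumv (levels T)) -xE addvv.
  rewrite levels_add in_setU1 => /orP[|//]; rewrite yE -[X in _ == X]addr0.
  by rewrite (inj_eq (addrI _)) addv_eq0 (negPf uv).
have levY : levels (y |: T) = levels T by rewrite levels_add (setUidPr _) ?sub1set.
(* Name the points of T such that a is on the level of y. *)
have [a aT ya] := imsetP yL.
have [b [c [bc TE]]] : exists b c, b != c /\ T :\ a = [set b; c].
  by apply/cards2P/eqP; have := cardsD1 a T; rewrite T3 aT => -[/esym].
have aN : a \notin [set b; c] by rewrite -TE !inE eqxx.
have {TE} TE : T = a |: (b |: [set c]) by rewrite -TE setD1K.
have bT' : b \in T by rewrite TE !inE eqxx !orbT.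
have cT : c \in T by rewrite TE !inE eqxx !orbT.
have aN' : a \notin b |: [set c] by [].
have bN : b \notin [set c] by rewrite inE.
have ab2 : a.2 != b.2 by apply: contraNneq aN => /(injT _ _ aT bT')->; rewrite !inE eqxx.
have ac2 : a.2 != c.2 by apply: contraNneq aN => /(injT _ _ aT cT)->; rewrite !inE eqxx orbT.
have bc2 : b.2 != c.2 by apply: contraNneq bc => /(injT _ _ bT' cT)->.
have sumE (R : nmodType) (F : X -> R) z : z \notin T ->
    (\sum_(t in z |: T) F t = F z + (F a + (F b + F c)))%R.
  by move=> zT; rewrite big_setU1 // TE big_setU1 //= big_setU1 //= big_set1.
move: eq_c; rewrite {1}/coarse levY levT3 /= => eq_c.
have [_ lab5 lab2] := triple_inj eq_c.
have fibY w : #|layer (y |: T) w| = (a.2 == w) + ((a.2 == w) + ((b.2 == w) + (c.2 == w))).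
  rewrite card_layer_add // TE !card_layer_add // ya -[[set c]]setU0 card_layer_add ?inE //.
  by rewrite (_ : layer set0 w = set0) ?cards0 ?addn0 //; apply/setP=> z; rewrite !inE.
have weightY w n : #|layer (y |: T) w| = n ->
    weight (y |: T) w = ((rank (levels T) w - rank (levels T) x.2) / n%:R)%R.
  by move=> <-; rewrite /weight levY xE.
(* Modulo 5 the labels are compared by the midpoint argument. *)
have a5 : res5 a = res5 y.
  have vE : (u + (u + v) = v)%R by rewrite addvK.
  have rank_v : rank (levels T) v = (res5 x + (res5 a + (res5 b + res5 c)))%R.
    by rewrite rank_corner // -tot5E /tot5 sumE.
  move: lab5; rewrite /label5 /label3 levY !sumE // -xE !rankE -uvE -/u vE rank_v.
  rewrite (weightY y.2 2) ?(weightY a.2 2) ?(weightY b.2 1) ?(weightY c.2 1).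
  - rewrite -ya; apply: midpoint_cancel => //.
    rewrite (inj_in_eq (rank_inj bT)) ?planeT ?levels_add ?setU11 //.
      by apply: contraNneq xL => <-.
    by rewrite in_setU1 yL orbT.
  - by rewrite fibY (negPf ac2) (negPf bc2) eqxx.
  - by rewrite fibY (negPf ab2) (eq_sym c.2) (negPf bc2) eqxx.
  - by rewrite fibY eqxx !(eq_sym _ a.2) (negPf ab2) (negPf ac2).
  - by rewrite fibY -ya eqxx !(eq_sym _ y.2) ya (negPf ab2) (negPf ac2).
(* Modulo 2, by cases on whether corner 0 is on the side of x and a or on that of b and c. *)
have a2 : res2 a = res2 y.
  move: lab2 tot2E; rewrite /label2 big_mkcondr /tot2 !sumE //= => lab2 tot2E.
  apply: (F2_cancel tot2E).
  have vE : v = (u + (x.2 + a.2))%R by rewrite -ya yE addvK addvK.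
  have xabc : (x.2 + a.2 = b.2 + c.2)%R.
    apply/eqP; rewrite -addv_eq0 -!addrA; move: sgx; rewrite /level_sum sumE // => ->.
    exact: eqxx.
  have [xa xb xc] : [/\ x.2 != a.2, x.2 != b.2 & x.2 != c.2].
    by split; apply: contraNneq xL => ->; apply: imset_f.
  have neq_sym (s w : V) : s != w -> ((s == w) = false) * ((w == s) = false).
    by move=> sw; split; rewrite 1?[w == s]eq_sym; exact: negPf.
  pose neqs := (neq_sym _ _ xa, neq_sym _ _ xb, neq_sym _ _ xc,
                neq_sym _ _ ab2, neq_sym _ _ ac2, neq_sym _ _ bc2).
  have := uL; rewrite levels_add TE !levels_add in_setU1 !in_setU1 /levels imset_set1 in_set1.
  case/or4P=> /eqP uE; rewrite vE uE in lab2.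
  - by left; rewrite -lab2 addvK !(eqxx, neqs) /= !addr0.
  - by left; rewrite -lab2 (addrC x.2) addvK !(eqxx, neqs) /= !addr0.
  - by right; rewrite -lab2 xabc addvK !(eqxx, neqs) /= !add0r.
  - by right; rewrite -lab2 xabc (addrC b.2) addvK !(eqxx, neqs) /= !add0r.
case/negP: yT; rewrite -(_ : a = y) //; exact: point_eq.
Qed.

Lemma coarse_packing T x y : #|T| = 3 -> x \notin T -> y \notin T ->
  2 < #|levels (x |: T)| -> 2 < #|levels (y |: T)| -> coarse (x |: T) = coarse (y |: T) -> x = y.
Proof.
move=> T3 xT yT Lx Ly eq_c.
case: (eqVneq x.2 y.2) => [xy2|xy2]; first exact: coarse_packing_level eq_c.
have neq_sg : level_sum (x |: T) != level_sum (y |: T).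
  by rewrite !level_sum_add // (inj_eq (addIr _)).
case: (boolP (ordinary (x |: T))) (boolP (ordinary (y |: T))) => ox [] oy.
- by case/eqP: neq_sg; rewrite -!coarse_ordinary // eq_c.
- by case: (coarse_mixed T3 yT xT oy ox Ly).
- by case: (coarse_mixed T3 xT yT ox oy Lx).
case/eqP: neq_sg; move: ox oy; rewrite !negb_or !negbK.
by move=> /andP[_ /eqP->] /andP[_ /eqP->].
Qed.

(** The omitted values 6, 2 and 8 are (1, 0), (2, 0) and (3, 0) in Z_5 x Z_2: the constants of the
    codes attached to directions. *)
Definition zero_sum i : 'F_5 * 'F_2 := residues (nth 0 [:: 0; 1; 3; 4; 5; 7; 9] (i %/ 9)).

Lemma residues_surj (j : 'F_5 * 'F_2) : exists2 n, n < 10 & residues n = j.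
Proof.
have : all (fun a => all (fun b => has (fun n => (n %% 5 == a) && (n %% 2 == b)) (iota 0 10))
  (iota 0 2)) (iota 0 5) by [].
move=> /allP/(_ j.1); rewrite mem_iota ltn_ord => /(_ isT)/allP/(_ j.2).
rewrite mem_iota ltn_ord => /(_ isT)/hasP[n]; rewrite mem_iota => n10 /andP[/eqP n5 /eqP n2].
exists n => //; case: j n5 n2 => a b /= n5 n2.
by congr (_, _); apply/val_inj; rewrite /= val_Fp_nat.
Qed.

Lemma card_res_colours j : 9 <= #|[set g : 'I_90 | residues (g %/ 9) == j]|.
Proof.
have [n n10 <-] := residues_surj j.
have : all (fun n => 9 <= count (fun g => g %/ 9 == n) (iota 0 90)) (iota 0 10) by [].
move=> /allP/(_ n); rewrite mem_iota n10 => /(_ isT); rewrite -card_ord_count => /leq_trans-> //.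
by apply/subset_leq_card/subsetP=> g; rewrite !inE => /eqP->.
Qed.

Lemma card_zero_colours Q : code_index Q = 0 ->
  9 <= #|[set i : 'I_63 | zero_sum i == (tot5 Q, tot2 Q)]|.
Proof.
move=> k0; have [n n10 nE] := residues_surj (tot5 Q, tot2 Q).
have : all (fun n => (n \in [:: 6; 2; 8]) ||
   (9 <= count (fun i => nth 0 [:: 0; 1; 3; 4; 5; 7; 9] (i %/ 9) == n) (iota 0 63)))
  (iota 0 10) by [].
move=> /allP/(_ n); rewrite mem_iota n10 => /(_ isT)/orP[n_code|].
  have n5 : tot5 Q = (n%:R)%R by rewrite -[tot5 Q]/((tot5 Q, tot2 Q).1) -nE.
  have n2 : tot2 Q = (n%:R)%R by rewrite -[tot2 Q]/((tot5 Q, tot2 Q).2) -nE.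
  by move: k0; rewrite /code_index n5 n2; move: n_code; rewrite !inE => /or3P[] /eqP->.
rewrite -card_ord_count => /leq_trans-> //.
by apply/subset_leq_card/subsetP=> i; rewrite !inE /zero_sum -nE => /eqP->.
Qed.

Lemma coarse_zero Q : #|Q| = 4 -> 2 < #|levels Q| -> (coarse Q).1 = 0%R ->
  code_index Q = 0 /\ coarse Q = (0%R, (tot5 Q, tot2 Q)).
Proof.
move=> Q4 L3; have Lb : 3 <= #|levels Q| <= 4 by rewrite L3 -Q4 card_levels.
rewrite /coarse; case: (eqVneq #|levels Q| 3) => [/(level_sum3_neq0 Q4)/eqP//|_].
case: ifP => [/eqP//|_]; case: (eqVneq (code_index Q) 0) => // k0 /= /eqP.
by rewrite addv_eq0 corner_eq ?code_index_lt4 // eq_sym (negPf k0).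
Qed.

(** * The systems of quadruples *)
Definition first L := nth 0%R (enum L) 0.
Definition second L := nth 0%R (enum L) 1.

Definition colour := ({s : V | s != 0%R} * 'I_90 + 'I_63)%type.

(** The systems of direction s contain no quadruple on a single level, and those of direction 0
    none with 3 + 1 points on two levels. *)
Definition system (c : colour) Q : bool :=
  let L := levels Q in let A := layer Q (first L) in let B := layer Q (second L) in
  match c with
  | inl (s, g) =>
      if #|L| == 2 then (val s == first L + second L)%R && mixed_block g A B
      else (2 < #|L|) && (coarse Q == (val s, residues (g %/ 9)))
  | inr i =>
      if #|L| == 1 then steiner (relabelling i @: A)
      else if #|L| == 2 then pair_block i A B
      else coarse Q == (0%R, zero_sum i)
  end.

Lemma levels1E L : #|L| = 1 -> L = [set first L].
Proof. by move=> /eqP/cards1P[u ->]; rewrite /first enum_set1. Qed.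

Lemma levels2E L : #|L| = 2 -> first L != second L /\ L = [set first L; second L].
Proof.
rewrite /first /second cardE; move: (enum_uniq L) (set_enum L).
case: (enum L) => [|u [|v []]] //=; rewrite !inE andbT => uv <- _; split=> //.
by apply/setP=> w; rewrite !inE.
Qed.

(** One level and the direction determine the other level. *)
Lemma levels2_partner L u : #|L| = 2 -> u \in L -> L = [set u; u + (first L + second L)]%R.
Proof.
move=> /levels2E[_ LE]; rewrite {1}LE !inE => /orP[] /eqP->; first by rewrite addvK.
by rewrite [(first L + _)%R]addrC addvK setUC.
Qed.

Lemma card_levels_sub x T : #|levels T| <= #|levels (x |: T)| <= (#|levels T|).+1.
Proof. by rewrite levels_add cardsU1; case: (_ \notin _); rewrite ?leqnn ?leqnSn. Qed.

Lemma card_levels_gt0 T : #|T| = 3 -> 0 < #|levels T|.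
Proof.
move=> T3; have /card_gt0P[t tT] : 0 < #|T| by rewrite T3.
by apply/card_gt0P; exists t.2; apply: imset_f.
Qed.

Lemma layer_two_levels x T : #|T| = 3 -> x \notin T -> #|levels (x |: T)| = 2 ->
  let u := first (levels (x |: T)) in let v := second (levels (x |: T)) in let b := x.2 == u in
  [/\ x.2 = (if b then u else v),
      layer (x |: T) u = side b x.1 (layer T u), layer (x |: T) v = side (~~ b) x.1 (layer T v),
      #|layer T u| + #|layer T v| = 3 & x.1 \notin (if b then layer T u else layer T v)].
Proof.
move=> T3 xT L2 /=; have [uv LE] := levels2E L2.
set u := first _ in uv LE *; set v := second _ in uv LE *.
have xL : x.2 \in [set u; v] by rewrite -LE levels_add setU11.
have x2 : x.2 = (if x.2 == u then u else v).
  by move: xL; rewrite !inE; case: eqP => //= _ /eqP.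
have bv : (x.2 == v) = ~~ (x.2 == u).
  case: (eqVneq x.2 u) => [->|ne]; first by rewrite (negPf uv).
  by rewrite x2 (negPf ne) eqxx.
split=> //.
- by rewrite layer_add.
- by rewrite layer_add bv.
- have := card_layers (x |: T); rewrite LE cardsU1 xT T3 big_setU1 ?inE //= big_set1.
  rewrite !card_layer_add // bv; case: (x.2 == u) => /=.
    by rewrite add0n -addnA => -[].
  by rewrite add0n addnCA => -[].
by move: (layer_notin xT); rewrite {1}x2; case: ifP.
Qed.

Lemma two_levels_packing (block : {set 'I_10} -> {set 'I_10} -> bool) T x y :
  (forall (A B : {set 'I_10}) s t a b, #|A| + #|B| = 3 ->
     a \notin (if s then A else B) -> b \notin (if t then A else B) ->
     block (side s a A) (side (~~ s) a B) -> block (side t b A) (side (~~ t) b B) ->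
     s = t /\ a = b) ->
  #|T| = 3 -> x \notin T -> y \notin T ->
  #|levels (x |: T)| = 2 -> levels (y |: T) = levels (x |: T) ->
  block (layer (x |: T) (first (levels (x |: T)))) (layer (x |: T) (second (levels (x |: T)))) ->
  block (layer (y |: T) (first (levels (y |: T)))) (layer (y |: T) (second (levels (y |: T)))) ->
  x = y.
Proof.
move=> packing T3 xT yT L2 eqL.
have := layer_two_levels T3 xT L2; have := layer_two_levels T3 yT; rewrite eqL => /(_ L2).
move=> /= [y2 -> -> _ yN] [x2 -> -> AB3 xN] bx bY.
have [eq_b xy1] := packing _ _ _ _ _ _ AB3 xN yN bx bY.
have xy2 : x.2 = y.2 by rewrite x2 eq_b -y2.
by rewrite [x]surjective_pairing [y]surjective_pairing xy1 xy2.
Qed.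

Lemma levels_eq_two T x y : #|T| = 3 -> #|levels (x |: T)| = 2 -> #|levels (y |: T)| = 2 ->
  (first (levels (x |: T)) + second (levels (x |: T)) =
   first (levels (y |: T)) + second (levels (y |: T)))%R ->
  levels (y |: T) = levels (x |: T).
Proof.
move=> T3 Lx Ly eq_s; have /card_gt0P[t tT] : 0 < #|T| by rewrite T3.
have tL z : t.2 \in levels (z |: T) by rewrite levels_add in_setU1 orbC imset_f.
by rewrite (levels2_partner Lx (tL x)) (levels2_partner Ly (tL y)) eq_s.
Qed.

Lemma levels_sub_eq x T : #|levels T| = #|levels (x |: T)| -> levels (x |: T) = levels T.
Proof.
move=> eqT; apply/esym/eqP; rewrite eqEcard levels_add subsetUr /= -levels_add.
by rewrite eqT.
Qed.

(** Two of the three points share their level, which cancels. *)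
Lemma level_sum_two_levels T : #|T| = 3 -> #|levels T| = 2 -> level_sum T \in levels T.
Proof.
move=> T3 L2.
have [x [y [xT yT xy xy2]]] : exists x y, [/\ x \in T, y \in T, x != y & x.2 = y.2].
  by apply: not_injective_pair; rewrite -/(levels T) L2 T3.
have : #|(T :\ x) :\ y| == 1.
  have := cardsD1 x T; have := cardsD1 y (T :\ x); rewrite xT T3 !inE eq_sym xy yT.
  by case: #|(T :\ x) :\ y| => [|[|k]] // -> .
move=> /cards1P[z zE]; have yTx : y \in T :\ x by rewrite !inE eq_sym xy.
have zT : z \in (T :\ x) :\ y by rewrite zE set11.
have TE : T = x |: (y |: [set z]) by rewrite -zE setD1K // setD1K.
have -> : level_sum T = z.2.
  rewrite TE level_sum_add; last by rewrite -zE !inE eqxx andbF (negPf xy).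
  rewrite level_sum_add; last by rewrite -zE !inE eqxx.
  by rewrite /level_sum big_set1 xy2 addvK.
by apply: imset_f; move: zT; rewrite !inE => /and3P[].
Qed.

(** Let T have levels u, u, v.  With a new level t the direction is v + t, which is neither 0 nor
    u + v. *)
Lemma coarse_neq_two_levels T x y : #|T| = 3 -> x \notin T -> y \notin T ->
  #|levels (x |: T)| = 2 -> #|levels T| = 2 -> 2 < #|levels (y |: T)| ->
  (coarse (y |: T)).1 != 0%R /\
  ((coarse (y |: T)).1 != first (levels (x |: T)) + second (levels (x |: T)))%R.
Proof.
move=> T3 xT yT Lx LT Ly.
have Ly3 : #|levels (y |: T)| = 3.
  by apply/eqP; rewrite eqn_leq Ly andbT; have /andP[_] := card_levels_sub y T; rewrite LT.
have ord : ordinary (y |: T) by rewrite /ordinary Ly3.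
have y4 : #|y |: T| = 4 by rewrite cardsU1 yT T3.
rewrite coarse_ordinary //; split; first exact: ordinary_neq0.
have yN : y.2 \notin levels T.
  by move: Ly3; rewrite levels_add cardsU1 LT; case: (_ \notin _).
rewrite levels_sub_eq ?LT ?Lx // level_sum_add //; apply: contraNneq yN => sE.
have sT := level_sum_two_levels T3 LT.
have := levels2_partner LT sT; rewrite -sE addrCA addvv addr0 => ->.
by rewrite !inE eqxx orbT.
Qed.

Lemma layer_one_level T u : levels T \subset [set u] -> #|layer T u| = #|T|.
Proof.
move=> sub; rewrite card_layerE; apply: eq_card => x; rewrite !inE.
case: (boolP (x \in T)) => //= xT; apply/eqP/set1P.
by apply: subsetP sub _ _; apply: imset_f.
Qed.

Lemma system_packing c T x y : #|T| = 3 -> x \notin T -> y \notin T ->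
  system c (x |: T) -> system c (y |: T) -> x = y.
Proof.
move=> T3 xT yT.
have LT0 := card_levels_gt0 T3.
have L2 z : #|levels (z |: T)| = 2 -> #|levels T| = 1 \/ #|levels T| = 2.
  have /andP[] := card_levels_sub z T; move: LT0.
  by case: #|levels T| => [|[|[|k]]] // _ le1 le2 eq2; [left | right | rewrite eq2 in le1].
have L3 z t : #|levels (z |: T)| = 2 -> 2 < #|levels (t |: T)| -> #|levels T| = 2.
  move=> /L2[LT|//]; have /andP[_] := card_levels_sub t T; rewrite LT => le2 gt2.
  by have := leq_trans gt2 le2.
case: c => [[s g]|i]; rewrite /system.
  case: (eqVneq #|levels (x |: T)| 2) => [Lx|_]; case: (eqVneq #|levels (y |: T)| 2) => [Ly|_].
  - move=> /andP[/eqP sx bx] /andP[/eqP sy bY].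
    apply: (two_levels_packing _ T3 xT yT Lx _ bx bY); first exact: mixed_block_packing.
    by apply: levels_eq_two => //; rewrite -sx sy.
  - move=> /andP[/eqP sx _] /andP[Ly /eqP cy].
    have [_] := coarse_neq_two_levels T3 xT yT Lx (L3 x y Lx Ly) Ly.
    by rewrite cy -sx eqxx.
  - move=> /andP[Lx /eqP cx] /andP[/eqP sy _].
    have [_] := coarse_neq_two_levels T3 yT xT Ly (L3 y x Ly Lx) Lx.
    by rewrite cx -sy eqxx.
  move=> /andP[Lx /eqP cx] /andP[Ly /eqP cy].
  by apply: (coarse_packing T3) => //; rewrite cx cy.
have gt2 z : #|levels (z |: T)| != 1 -> #|levels (z |: T)| != 2 -> 2 < #|levels (z |: T)|.
  have /andP[+ _] := card_levels_sub z T => /(leq_trans LT0).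
  by case: #|levels (z |: T)| => [|[|[|]]].
have L1 z : #|levels (z |: T)| = 1 -> #|levels T| = 1.
  move=> Lz; apply/eqP; rewrite eqn_leq LT0 andbT -Lz.
  by have /andP[] := card_levels_sub z T.
have pair_levels z : #|levels (z |: T)| = 2 ->
    pair_block i (layer (z |: T) (first (levels (z |: T))))
      (layer (z |: T) (second (levels (z |: T)))) ->
    #|levels T| = 2.
  move=> Lz /and3P[/eqP fA /eqP fB _]; have [LT|//] := L2 z Lz.
  have [u LTE] := cards1P (introT eqP LT).
  have uL : u \in levels (z |: T) by rewrite levels_add LTE !inE eqxx orbT.
  have : #|layer (z |: T) u| = 2.
    by have [_ LE] := levels2E Lz; move: uL; rewrite {1}LE !inE => /orP[] /eqP->.
  have : #|layer T u| <= #|layer (z |: T) u|.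
    by rewrite layer_add; case: eqP => // _; apply/subset_leq_card/subsetUr.
  by rewrite layer_one_level ?LTE // T3 => + f2; rewrite f2.
case: (eqVneq #|levels (x |: T)| 1) => [Lx|Lx1]; case: (eqVneq #|levels (y |: T)| 1) => [Ly|Ly1].
- have eqx := levels_sub_eq (etrans (L1 x Lx) (esym Lx)).
  have eqy := levels_sub_eq (etrans (L1 y Ly) (esym Ly)).
  have LTE := levels1E (L1 x Lx); rewrite eqx eqy; set u := first _ in LTE *.
  have level z : levels (z |: T) = levels T -> z.2 = u.
    by move=> eqz; apply/set1P; rewrite -LTE -eqz levels_add setU11.
  have xu := level x eqx; have yu := level y eqy.
  rewrite !layer_add xu yu eqxx !imsetU1 => bx bY.
  have fT3 : #|relabelling i @: layer T u| = 3.
    by rewrite card_imset ?layer_one_level ?LTE //; exact: relabelling_inj.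
  have notin z : z \notin T -> z.2 = u -> relabelling i z.1 \notin relabelling i @: layer T u.
    by move=> zT zu; rewrite mem_imset -?zu ?layer_notin //; exact: relabelling_inj.
  have := steiner_packing fT3 (notin x xT xu) (notin y yT yu) bx bY.
  by move/relabelling_inj; case: x y xu yu {bx bY xT yT Lx Ly eqx eqy} => [a v] [b w] /= -> -> ->.
- case: (eqVneq #|levels (y |: T)| 2) => [Ly _ /(pair_levels y Ly)|Ly2]; first by rewrite (L1 x Lx).
  have := gt2 y Ly1 Ly2; have /andP[_] := card_levels_sub y T.
  by rewrite (L1 x Lx) => le2 /leq_trans/(_ le2).
- case: (eqVneq #|levels (x |: T)| 2) => [Lx /(pair_levels x Lx)|Lx2]; first by rewrite (L1 y Ly).
  have := gt2 x Lx1 Lx2; have /andP[_] := card_levels_sub x T.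
  by rewrite (L1 y Ly) => le2 /leq_trans/(_ le2).
case: (eqVneq #|levels (x |: T)| 2) => [Lx|Lx2]; case: (eqVneq #|levels (y |: T)| 2) => [Ly|Ly2].
- move=> bx bY; have LT := pair_levels x Lx bx.
  apply: (two_levels_packing _ T3 xT yT Lx _ bx bY); first exact: pair_block_packing.
  have eqx : levels (x |: T) = levels T by apply: levels_sub_eq; rewrite LT Lx.
  by rewrite eqx; apply: levels_sub_eq; rewrite LT Ly.
- move=> bx /eqP cy; have LT := pair_levels x Lx bx.
  have [] := coarse_neq_two_levels T3 xT yT Lx LT (gt2 y Ly1 Ly2).
  by rewrite cy eqxx.
- move=> /eqP cx bY; have LT := pair_levels y Ly bY.
  have [] := coarse_neq_two_levels T3 yT xT Ly LT (gt2 x Lx1 Lx2).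
  by rewrite cx eqxx.
move=> /eqP cx /eqP cy.
by apply: (coarse_packing T3); rewrite ?gt2 // cx cy.
Qed.

Lemma card_inr_systems (P : pred 'I_63) Q : (forall i, P i -> system (inr i) Q) ->
  #|[set i | P i]| <= #|[set c | system c Q]|.
Proof.
move=> sP; rewrite -(card_imset _ (@inr_inj ({s : V | s != 0%R} * 'I_90)%type _)).
apply/subset_leq_card/subsetP=> _ /imsetP[i + ->]; rewrite !inE; exact: sP.
Qed.

Lemma card_systems (R : pred 'I_90) (P : pred 'I_63) s Q :
  (forall g, R g -> system (inl (s, g)) Q) -> (forall i, P i -> system (inr i) Q) ->
  #|[set g | R g]| + #|[set i | P i]| <= #|[set c | system c Q]|.
Proof.
move=> sR sP; have inj_s : injective (fun g => inl (s, g) : colour) by move=> g g' [].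
have inj_r : injective (fun i => inr i : colour) by move=> i i' [].
rewrite -(card_imset _ inj_s) -[X in _ + X <= _](card_imset _ inj_r) -cardsUI.
rewrite [X in _ + X](_ : _ = 0) ?addn0.
  apply/subset_leq_card/subsetP=> c; rewrite in_setU => /orP[] /imsetP[z + ->]; rewrite !inE.
    exact: sR.
  exact: sP.
apply/eqP; rewrite cards_eq0; apply/eqP/setP=> c; rewrite in_setI in_set0; apply/negP=> /andP[].
by move=> /imsetP[g _ ->] /imsetP[].
Qed.

Lemma card_inl_systems (R : pred 'I_90) s Q : (forall g, R g -> system (inl (s, g)) Q) ->
  #|[set g | R g]| <= #|[set c | system c Q]|.
Proof.
move=> sR; apply: leq_trans (card_systems (P := pred0) sR _) => //.
exact: leq_addr.
Qed.

(** Two pairs on two levels are the only quadruples whose 9 systems are of both kinds: 2 of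
    direction s and 7 of direction 0. *)
Lemma system_cover Q : #|Q| = 4 -> 9 <= #|[set c | system c Q]|.
Proof.
move=> Q4; have L0 : 0 < #|levels Q|.
  have /card_gt0P[x xQ] : 0 < #|Q| by rewrite Q4.
  by apply/card_gt0P; exists x.2; apply: imset_f.
case: (eqVneq #|levels Q| 1) => [L1|L1].
  have A4 : #|layer Q (first (levels Q))| = 4 by rewrite layer_one_level -?levels1E.
  apply: leq_trans (steiner_large_set A4) (card_inr_systems _) => i; by rewrite /system L1.
case: (eqVneq #|levels Q| 2) => [L2|L2].
  have [uv LE] := levels2E L2; set u := first _ in uv LE; set v := second _ in uv LE.
  have uL : u \in levels Q by rewrite LE !inE eqxx.
  have vL : v \in levels Q by rewrite LE !inE eqxx orbT.
  have s0 : (u + v != 0)%R by rewrite addv_eq0.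
  have AB4 : #|layer Q u| + #|layer Q v| = 4.
    by have := card_layers Q; rewrite Q4 LE big_setU1 ?inE //= big_set1.
  pose s : {s : V | s != 0%R} := exist (fun w : V => is_true (w != 0%R)) _ s0.
  have sysl g : mixed_block g (layer Q u) (layer Q v) -> system (inl (s, g)) Q.
    by rewrite /system L2 /= eqxx.
  have sysr i : pair_block i (layer Q u) (layer Q v) -> system (inr i) Q by rewrite /system L2.
  move: AB4; have := layer_gt0 Q u; have := layer_gt0 Q v; rewrite uL vL.
  case Au: #|layer Q u| => [|[|[|[|k]]]] //; case Bv: #|layer Q v| => [|[|[|[|k']]]] // _ _;
    rewrite ?(addSn, addnS) // => _.
  - exact: leq_trans (mixed_block_cover13 Au Bv) (card_inl_systems sysl).
  - apply: leq_trans (card_systems sysl sysr).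
    exact: (leq_add (mixed_block_cover22 Au Bv) (pair_block_cover Au Bv)).
  - exact: leq_trans (mixed_block_cover31 Au Bv) (card_inl_systems sysl).
have gt2 n : 0 < n -> n != 1 -> n != 2 -> 2 < n by case: n => [|[|[|]]].
have L3 : 2 < #|levels Q| by apply: gt2.
case: (eqVneq (coarse Q).1 0%R) => [c0|c0].
  have [k0 cE] := coarse_zero Q4 L3 c0.
  apply: leq_trans (card_zero_colours k0) (card_inr_systems _) => i.
  by rewrite /system (negPf L1) (negPf L2) cE => /eqP->.
pose s : {s : V | s != 0%R} := exist (fun w : V => is_true (w != 0%R)) _ c0.
apply: leq_trans (card_res_colours (coarse Q).2) (card_inl_systems (s := s) _) => g.
by rewrite /system (negPf L2) L3 /= => /eqP->; rewrite -surjective_pairing.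
Qed.

(** With N the order of V: 90 * (N - 1) + 63 = 9 * (10 * N - 3). *)
Lemma card_colours : #|{: colour}| = (#|{: X}| - 3) * 9.
Proof.
rewrite card_sum card_prod !card_ord card_sig card_prod card_ord.
rewrite (eq_card (_ : _ =i predC1 0%R)) // cardC1.
have : 0 < #|V| by apply/card_gt0P; exists 0%R.
by case: #|V| => // k _; rewrite /=; lia.
Qed.
End Levels.

Theorem corollary11 (h l : nat) (hh : 1 <= h) (hl : 1 <= l) :
  GDD_exists 4 5
    (5 * 2 ^ l * (9 * h) + (5 * 2 ^ l - 3) * (9 * h))
    [:: (9 * h, 5 * 2 ^ l); ((5 * 2 ^ l - 3) * (9 * h), 1)].
Proof.
(* n = 10 * 2 ^ (l - 1), which is where 1 <= l is needed. *)
case: l hl => // m _; pose V := 'rV['F_2]_m.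
have addvv (v : V) : (v + v = 0)%R.
  apply/matrixP=> i j; rewrite !mxE -mulr2n -mulr_natr.
  by rewrite (_ : 2%:R = 0)%R ?mulr0 //; apply: val_inj.
have cardX : #|{: 'I_10 * V}| = 5 * 2 ^ m.+1.
  by rewrite card_prod card_ord card_mx card_Fp // mul1n expnS mulnA.
rewrite -cardX.
apply: (GDD_of_systems _ _ hh (card_colours V) (system_packing addvv) (system_cover addvv)) => //.
by rewrite cardX; have := expn_gt0 2 m.+1; case: (2 ^ m.+1) => // k; lia.
Qed.
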